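(* Let $K$ be any real valued field and let $f,g\in K\{x\}=K\{x_1,\dots,x_n\}$ with $\operatorname{ord}(f)\ge 2$. 1. If $\tau(f)<\infty$, the following are equivalent: (i) $f$ is contact equivalent to $g$. (ii) $T_k(f)\cong T_k(g)$ as $K$-algebras for some (equivalently, for all) $k\ge 2(\tau(f)-\operatorname{ord}(f)+2)$. 2. If $\mu(f)<\infty$, the following are equivalent: (i) $f$ is right equivalent to $g$. (ii) $M_k(f)\cong M_k(g)$ as $K\{t\}$-algebras for some (equivalently, for all) $k\ge 2(\mu(f)-\operatorname{ord}(f)+2)$.
   Context: A real valued field is a field $K$ with a map $|\ |:K\to\mathbb{R}_{\ge 0}$ satisfying $|a|=0\Leftrightarrow a=0$, $|ab|=|a||b|$, $|a+b|\le|a|+|b|$ (the trivial valuation is allowed; $K$ need not be complete). For $x=(x_1,\dots,x_n)$, $K\{x\}\subseteq K[[x]]$ is the ring of convergent power series: those $f=\sum_\alpha c_\alpha x^\alpha$ for which $\sum_\alpha|c_\alpha|\varepsilon^\alpha<\infty$ for some $\varepsilon\in(\mathbb{R}_{>0})^n$. $\mathfrak{m}=\langle x_1,\dots,x_n\rangle$ is its maximal ideal, and $\operatorname{ord}(f)=\max\{l\mid f\in\mathfrak{m}^l\}$ for $f\ne 0$, $\operatorname{ord}(0)=\infty$. $\operatorname{Aut}(K\{x\})$ is the group of automorphisms of $K\{x\}$ as a local $K$-algebra. $f,g\in K\{x\}$ are right equivalent if $f=\varphi(g)$ for some $\varphi\in\operatorname{Aut}(K\{x\})$, and contact equivalent if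 $f=u\cdot\varphi(g)$ for some $\varphi\in\operatorname{Aut}(K\{x\})$ and some unit $u\in K\{x\}^*$. $j(f)=\langle\frac{\partial f}{\partial x_1},\dots,\frac{\partial f}{\partial x_n}\rangle$; $\mu(f)=\dim_K K\{x\}/j(f)$; $\tau(f)=\dim_K K\{x\}/\langle f,j(f)\rangle$. For $k\ge 0$, $T_k(f)=K\{x\}/\langle f,\mathfrak{m}^kj(f)\rangle$ (the $k$-th Tjurina algebra) and $M_k(f)=K\{x\}/\mathfrak{m}^kj(f)$ (the $k$-th Milnor algebra). $M_k(f)$ is a $K\{t\}$-algebra ($t$ one variable) with $t$ acting by multiplication with $f$, and $M_k(g)$ is a $K\{t\}$-algebra with $t$ acting by multiplication with $g$; thus an isomorphism $\varphi:M_k(f)\to M_k(g)$ of $K\{t\}$-algebras is a $K$-algebra isomorphism mapping the class of $f$ to the class of $g$. *)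

(* Defs.v *)
From HB Require Import structures.
From mathcomp Require Import all_boot all_order all_algebra.
From mathcomp Require Import finmap mpoly.
From mathcomp Require Import all_classical all_reals.
From mathcomp Require Import ereal esum.

Set Implicit Arguments.
Unset Strict Implicit.
Unset Printing Implicit Defensive.
Import Order.TTheory GRing.Theory Num.Theory.
Local Open Scope classical_set_scope.
Local Open Scope ring_scope.
Local Open Scope quotient_scope.

Record absValue (R : realType) (K : fieldType) := AbsValue {
  absv :> K -> R;
  absv_ge0 : forall a, 0 <= absv a;
  absv_eq0 : forall a, absv a = 0 <-> a = 0;
  absvM : forall a b, absv (a * b) = absv a * absv b;
  absvD : forall a b, absv (a + b) <= absv a + absv b
}.

(* The alias hides the pointwise ring structure on functions into K. *)
Definition fps (n : nat) (K : fieldType) : Type := 'X_{1..n} -> K.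

Section FormalPowerSeries.
Context {n : nat} {K : fieldType}.
Implicit Types (f g h : fps n K) (m : 'X_{1..n}).

HB.instance Definition _ := GRing.Lmodule.copy (fps n K) ('X_{1..n} -> K^o).

Definition fps_one : fps n K := fun m => (m == 0%MM)%:R.

Definition fps_mul f g : fps n K := fun m =>
  \sum_(k : 'X_{1..n < (mdeg m).+1} | (k <= m)%MM) f k * g (m - k)%MM.

(* Truncations transfer the ring axioms from {mpoly K[n]}. *)
Definition fps_trunc (d : nat) f : {mpoly K[n]} :=
  \sum_(m : 'X_{1..n < d}) f m *: 'X_[m].

Lemma fps_truncE d f m : (mdeg m < d)%N -> (fps_trunc d f)@_m = f m.
Proof. exact: mcoeff_mpoly. Qed.

Lemma fps_mulE d f g m : (mdeg m < d)%N ->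
  fps_mul f g m = (fps_trunc d f * fps_trunc d g)@_m.
Proof.
move=> md; have -> : (fps_trunc d f * fps_trunc d g)@_m =
    \sum_(k : 'X_{1..n < (mdeg m).+1} | (k <= m)%MM)
       (fps_trunc d f)@_k * (fps_trunc d g)@_(m - k)%MM.
  exact: mcoeff_poly_mul_lin.
apply: eq_bigr => k km.
have kd : (mdeg k < d)%N by apply: leq_ltn_trans md; rewrite -ltnS bmdeg.
by rewrite !fps_truncE // (leq_ltn_trans _ md) // mdegB.
Qed.

Lemma fps_truncM d f g m : (mdeg m < d)%N ->
  (fps_trunc d (fps_mul f g))@_m = (fps_trunc d f * fps_trunc d g)@_m.
Proof. by move=> md; rewrite fps_truncE // (@fps_mulE d). Qed.

Lemma mcoeffM_eq d (p p' q q' : {mpoly K[n]}) m : (mdeg m < d)%N ->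
  (forall k, (mdeg k < d)%N -> p@_k = p'@_k) ->
  (forall k, (mdeg k < d)%N -> q@_k = q'@_k) -> (p * q)@_m = (p' * q')@_m.
Proof.
move=> md pp qq; rewrite !mcoeffM; apply: eq_bigr => k _.
have kd (l : 'X_{1..n < (mdeg m).+1}) : (mdeg l < d)%N.
  by apply: leq_ltn_trans md; rewrite -ltnS bmdeg.
by rewrite pp ?qq.
Qed.

Lemma fps_mulA : associative fps_mul.
Proof.
move=> f g h; apply/funext => m; pose d := (mdeg m).+1.
rewrite !(@fps_mulE d) //.
transitivity (fps_trunc d f * (fps_trunc d g * fps_trunc d h))@_m.
  by apply: (@mcoeffM_eq d) => // k; exact: fps_truncM.
rewrite mulrA; apply: (@mcoeffM_eq d) => // k kd.
by rewrite fps_truncM.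
Qed.

Lemma fps_mulC : commutative fps_mul.
Proof.
by move=> f g; apply/funext => m; rewrite !(@fps_mulE (mdeg m).+1) // mulrC.
Qed.

Lemma fps_mul1 : left_id fps_one fps_mul.
Proof.
move=> f; apply/funext => m; pose d := (mdeg m).+1.
rewrite (@fps_mulE d) //.
transitivity (1 * fps_trunc d f)@_m; last by rewrite mul1r fps_truncE.
by apply: (@mcoeffM_eq d) => // k kd; rewrite fps_truncE // mcoeff1.
Qed.

Lemma fps_mulDl : left_distributive fps_mul +%R.
Proof.
move=> f g h; apply/funext => m.
rewrite [RHS]/GRing.add/= /fps_mul -big_split; apply: eq_bigr => k _.
exact: mulrDl.
Qed.

Lemma fps_one_neq0 : fps_one != 0.
Proof.
apply/eqP => /(congr1 (fun f => f 0%MM)); rewrite /fps_one eqxx => /eqP.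
by rewrite oner_eq0.
Qed.

HB.instance Definition _ := GRing.Zmodule_isComNzRing.Build (fps n K)
  fps_mulA fps_mulC fps_mul1 fps_mulDl fps_one_neq0.

Lemma fps_scaleAl (a : K) f g : a *: (f * g) = (a *: f) * g.
Proof.
apply/funext => m; rewrite [LHS]/GRing.scale/= [f * g]/GRing.mul/= /fps_mul.
rewrite [in LHS]/GRing.scale/= mulr_sumr.
by apply: eq_bigr => k _; rewrite mulrA.
Qed.

HB.instance Definition _ := GRing.Lmodule_isLalgebra.Build K (fps n K) fps_scaleAl.
HB.instance Definition _ := GRing.Lalgebra_isComAlgebra.Build K (fps n K).

End FormalPowerSeries.

Section AbsValueTheory.
Context {R : realType} {K : fieldType} (v : absValue R K).

Lemma absv0 : v 0 = 0. Proof. exact/absv_eq0. Qed.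

Lemma absv1 : v 1 = 1.
Proof.
have v1 : v 1 != 0 by apply/eqP => /absv_eq0/eqP; rewrite oner_eq0.
by apply: (mulfI v1); rewrite -absvM !mulr1.
Qed.

Lemma absvN a : v (- a) = v a.
Proof.
suff vN1 : v (-1) = 1 by rewrite -mulN1r absvM vN1 mul1r.
apply/eqP; rewrite -(@eqrXn2 _ 2) ?absv_ge0 // expr1n expr2 -absvM.
by rewrite mulrNN mulr1 absv1.
Qed.

Lemma absv_nat k : v k%:R <= k%:R.
Proof.
elim: k => [|k IH]; first by rewrite absv0.
by rewrite -[k.+1]addn1 !natrD (le_trans (absvD _ _ _)) // absv1 lerD2r.
Qed.

Lemma absv_sum (I : Type) (r : seq I) (P : pred I) (F : I -> K) :
  v (\sum_(i <- r | P i) F i) <= \sum_(i <- r | P i) v (F i).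
Proof.
elim/big_rec2: _ => [|i y x _ le_xy]; first by rewrite absv0.
by rewrite (le_trans (absvD _ _ _)) // lerD2l.
Qed.

End AbsValueTheory.

Section Convergence.
Context {R : realType} {K : fieldType} (n : nat) (v : absValue R K).
Implicit Types (f g : fps n K) (e : 'I_n -> R) (m : 'X_{1..n}).

Definition mweight e m : R := \prod_(i < n) e i ^+ m i.

Definition convergent f : Prop := exists2 e : 'I_n -> R,
  (forall i, 0 < e i) &
  (\esum_(m in [set: 'X_{1..n}]) (v (f m) * mweight e m)%:E < +oo)%E.

Definition bounded_sums e f := exists M : R, forall s : seq 'X_{1..n},
  uniq s -> \sum_(m <- s) v (f m) * mweight e m <= M.

Lemma mweight_ge0 e m : (forall i, 0 < e i) -> 0 <= mweight e m.
Proof. by move=> e0; apply: prodr_ge0 => i _; apply/exprn_ge0/ltW. Qed.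

Lemma mweightD e m m' : mweight e (m + m')%MM = mweight e m * mweight e m'.
Proof.
by rewrite /mweight -big_split; apply: eq_bigr => i _; rewrite mnmDE exprD.
Qed.

Lemma mweight1 e i : mweight e U_(i)%MM = e i.
Proof.
rewrite /mweight (bigD1 i) //= mnm1E eqxx expr1 big1 ?mulr1 // => j ji.
by rewrite mnm1E eq_sym (negbTE ji) expr0.
Qed.

Lemma term_ge0 e f m : (forall i, 0 < e i) -> 0 <= v (f m) * mweight e m.
Proof. by move=> e0; rewrite mulr_ge0 ?absv_ge0 ?mweight_ge0. Qed.

Lemma bounded_sumsP e f : (forall i, 0 < e i) ->
  (\esum_(m in [set: 'X_{1..n}]) (v (f m) * mweight e m)%:E < +oo)%E <->
  bounded_sums e f.
Proof.
move=> e0; split=> [foo|[M fM]].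
  set S := esum _ _ in foo.
  have Sge0 : (0 <= S)%E by apply: esum_ge0 => m _; rewrite lee_fin term_ge0.
  exists (fine S) => s us.
  rewrite -lee_fin fineK ?ge0_fin_numE // -sumEFin.
  apply: ereal_sup_ubound; exists [set` s]; last by rewrite -fsbig_seq.
  by split => //; exact: finite_seq.
apply: (@le_lt_trans _ _ M%:E); last exact: ltry.
apply: ge_ereal_sup => _ [X [finX _] <-].
by rewrite fsbig_finite // sumEFin lee_fin fM // fset_uniq.
Qed.

Lemma bounded_sums_le e e' f : (forall i, 0 < e i) -> (forall i, e i <= e' i) ->
  bounded_sums e' f -> bounded_sums e f.
Proof.
move=> e0 ee' [M fM]; exists M => s /fM; apply: le_trans.
apply: ler_sum => m _; rewrite ler_wpM2l ?absv_ge0 //.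
apply: ler_prod => i _; rewrite exprn_ge0 ?(ltW (e0 i)) //=.
by rewrite lerXn2r ?nnegrE ?(ltW (e0 i)) // (le_trans (ltW (e0 i))).
Qed.

Lemma convergentP f : convergent f <->
  exists2 e, (forall i, 0 < e i) & bounded_sums e f.
Proof.
by split=> -[e e0 fe]; exists e => //; move: fe => /(bounded_sumsP _ e0).
Qed.

Lemma convergent2 f g : convergent f -> convergent g ->
  exists2 e, (forall i, 0 < e i) & bounded_sums e f /\ bounded_sums e g.
Proof.
move=> /convergentP[e e0 fe] /convergentP[e' e'0 ge'].
exists (fun i => Num.min (e i) (e' i)) => [i|]; first by rewrite lt_min e0 e'0.
by split; [apply: bounded_sums_le fe|apply: bounded_sums_le ge'] => i;
  rewrite ?lt_min ?e0 ?e'0 // ge_min lexx ?orbT.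
Qed.

Lemma bounded_sums_fin e f (s0 : seq 'X_{1..n}) : (forall i, 0 < e i) ->
  (forall m, m \notin s0 -> f m = 0) -> bounded_sums e f.
Proof.
move=> e0 f0; exists (\sum_(m <- undup s0) v (f m) * mweight e m) => s us.
rewrite (bigID (mem s0)) /= [X in _ + X]big1 ?addr0; last first.
  by move=> m /f0->; rewrite absv0 mul0r.
rewrite -big_filter [leRHS](bigID (mem s)) /= -[leLHS]addr0 lerD //; last first.
  by apply: sumr_ge0 => m _; exact: term_ge0.
rewrite -[leRHS]big_filter le_eqVlt; apply/orP; left; apply/eqP/perm_big.
apply: uniq_perm; rewrite ?filter_uniq ?undup_uniq // => m.
by rewrite !mem_filter mem_undup andbC.
Qed.

Lemma convergent_fin f (s0 : seq 'X_{1..n}) :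
  (forall m, m \notin s0 -> f m = 0) -> convergent f.
Proof.
move=> f0; apply/convergentP; exists (fun=> 1) => // .
by apply: bounded_sums_fin f0.
Qed.

Lemma bounded_sums_mul e f g : (forall i, 0 < e i) ->
  bounded_sums e f -> bounded_sums e g -> bounded_sums e (f * g).
Proof.
move=> e0 [M fM] [N gN].
have M0 : 0 <= M by have := fM [::] isT; rewrite big_nil.
exists (M * N) => s us.
pose d := (\max_(m <- s) mdeg m).+1.
pose a h (k : 'X_{1..n}) := v (h k : K) * mweight e k.
have fgE m : m \in s -> v ((f * g) m) * mweight e m <=
    \sum_(k : 'X_{1..n < d, d} | m == (k.1 + k.2)%MM) a f k.1 * a g k.2.
  move=> ms; have md : (mdeg m < d)%N by rewrite ltnS leq_bigmax_seq.
  have -> : (f * g) m = \sum_(k : 'X_{1..n < d, d} | m == (k.1 + k.2)%MM)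
      f k.1 * g k.2.
    rewrite [LHS](@fps_mulE _ _ d) //.
    have -> : (fps_trunc d f * fps_trunc d g)@_m =
      \sum_(k : 'X_{1..n < d, d} | m == (k.1 + k.2)%MM)
       (fps_trunc d f)@_k.1 * (fps_trunc d g)@_k.2.
      exact: mcoeff_poly_mul.
    by apply: eq_bigr => k _; rewrite !fps_truncE ?bmdeg.
  rewrite (le_trans (ler_wpM2r _ (absv_sum _ _ _ _))) ?mweight_ge0 //.
  rewrite mulr_suml; apply: ler_sum => k /eqP->.
  by rewrite mweightD absvM mulrACA.
rewrite big_seq (le_trans (ler_sum _ fgE)) //.
rewrite -big_seq (exchange_big_dep xpredT) //=.
apply: (@le_trans _ _ (\sum_(k : 'X_{1..n < d, d}) a f k.1 * a g k.2)).
  apply: ler_sum => k _; rewrite -big_filter.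
  have akk : 0 <= a f k.1 * a g k.2 by rewrite mulr_ge0 ?term_ge0.
  have [ks|ks] := boolP ((k.1 + k.2)%MM \in s).
    by rewrite (filter_pred1_uniq us ks) big_seq1.
  rewrite big_filter big_seq_cond big_pred0 // => m.
  by apply: contraNF ks => /andP[ms /eqP <-].
rewrite -(pair_bigA _ (fun k1 k2 : 'X_{1..n < d} => a f k1 * a g k2)) /=.
under eq_bigr do rewrite -mulr_sumr; rewrite -mulr_suml.
have aux h L : (forall s, uniq s -> \sum_(m <- s) a h m <= L) ->
    \sum_(k : 'X_{1..n < d}) a h k <= L.
  move=> /(_ [seq bmnm k | k <- index_enum 'X_{1..n < d}]).
  rewrite big_map; apply; rewrite map_inj_uniq ?index_enum_uniq //.
  exact: val_inj.
by apply: ler_pM; rewrite ?aux ?sumr_ge0 // => k _; exact: term_ge0.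
Qed.

Definition convergentp : pred (fps n K) := [pred f | `[<convergent f>]].

Lemma convergent_subalg : GRing.subalg_closed convergentp.
Proof.
split=> [|a f g|f g]; rewrite !inE ?asboolE.
- apply: (convergent_fin (s0 := [:: 0%MM])) => m; rewrite inE => m0.
  by rewrite [LHS]/GRing.one/= /fps_one (negbTE m0).
- move=> cf cg; apply/convergentP.
  have [e e0 [[M fM] [N gN]]] := convergent2 cf cg.
  exists e => //; exists (v a * M + N) => s us.
  apply: (@le_trans _ _ (\sum_(m <- s) (v a * (v (f m) * mweight e m) +
                                       v (g m) * mweight e m))).
    apply: ler_sum => m _; rewrite mulrA -mulrDl ler_wpM2r ?mweight_ge0 //.
    by rewrite -absvM; exact: absvD.
  rewrite big_split /= -mulr_sumr lerD ?gN // ler_wpM2l ?absv_ge0 //.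
  exact: fM.
- move=> cf cg; apply/convergentP.
  have [e e0 [fe ge]] := convergent2 cf cg.
  by exists e => //; exact: bounded_sums_mul.
Qed.

HB.instance Definition _ := GRing.isSubalgClosed.Build K (fps n K) convergentp
  (GRing.subalg_closed_semi convergent_subalg).

End Convergence.


Record cps (n : nat) (R : realType) (K : fieldType) (v : absValue R K) := Cps {
  cps_val :> fps n K;
  cps_valP : cps_val \in convergentp v
}.

Section ConvergentPowerSeries.
Context {n : nat} {R : realType} {K : fieldType} {v : absValue R K}.

HB.instance Definition _ := [isSub for @cps_val n R K v].
HB.instance Definition _ := [Choice of cps n v by <:].
HB.instance Definition _ := [SubChoice_isSubAlgebra of cps n v by <:].
HB.instance Definition _ := [SubNzRing_isSubComNzRing of cps n v by <:].

Definition cps_unit : pred (cps n v) := fun u => `[<exists w, w * u = 1>].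

Definition cps_inv (u : cps n v) : cps n v :=
  if pselect (exists w, w * u = 1) is left e then sval (cid e) else u.

Lemma cps_mulVu : {in cps_unit, left_inverse 1 cps_inv *%R}.
Proof.
move=> u /asboolP uU; rewrite /cps_inv; case: pselect => // e.
by case: cid.
Qed.

Lemma cps_unitPl u w : w * u = 1 -> cps_unit u.
Proof. by move=> wu; apply/asboolP; exists w. Qed.

Lemma cps_inv_out : {in [predC cps_unit], cps_inv =1 id}.
Proof.
move=> u /negP uU; rewrite /cps_inv; case: pselect => // e.
by case: uU; apply/asboolP.
Qed.

HB.instance Definition _ := GRing.ComNzRing_hasMulInverse.Build (cps n v)
  cps_mulVu cps_unitPl cps_inv_out.

Definition fps_var (i : 'I_n) : fps n K := fun m => (m == U_(i)%MM)%:R.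

Lemma fps_var_convergent i : fps_var i \in convergentp v.
Proof.
apply/asboolP; apply: (@convergent_fin _ _ _ _ _ [:: U_(i)%MM]) => m.
by rewrite /fps_var inE => /negbTE->.
Qed.

Definition cps_var i : cps n v := Cps (fps_var_convergent i).

Definition fps_deriv (i : 'I_n) (f : fps n K) : fps n K :=
  fun m => f (m + U_(i))%MM *+ (m i).+1.

Lemma fps_deriv_convergent i (f : fps n K) :
  f \in convergentp v -> fps_deriv i f \in convergentp v.
Proof.
move=> /asboolP/convergentP[e e0 [M fM]]; apply/asboolP/convergentP.
exists (fun j => e j / 2) => [j|]; first by rewrite divr_gt0.
exists (M / e i) => s us; rewrite ler_pdivlMr //.
have := fM [seq (m + U_(i))%MM | m <- s].
rewrite map_inj_uniq => [/(_ us)|]; last exact: addIm.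
apply: le_trans; rewrite big_map mulr_suml; apply: ler_sum => m _.
rewrite [fps_deriv i f m]/fps_deriv -[_ *+ _]mulr_natr absvM mweightD mweight1 -!mulrA.
rewrite ler_wpM2l ?absv_ge0 // mulrA ler_wpM2r ?(ltW (e0 i)) //.
have -> : mweight (fun j => e j / 2) m = mweight e m * \prod_(j < n) 2^-1 ^+ m j.
  by rewrite /mweight -big_split; apply: eq_bigr => j _; rewrite exprMn.
rewrite mulrCA ler_piMr ?mweight_ge0 //.
have half0 k : 0 <= (2^-1 : R) ^+ k by rewrite exprn_ge0 // invr_ge0.
apply: (@le_trans _ _ ((m i).+1%:R * 2^-1 ^+ m i)).
  rewrite (bigD1 i) //= ler_pM ?absv_ge0 ?absv_nat ?mulr_ge0 ?prodr_ge0 //.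
  rewrite ler_piMr // prodr_ile1 // => j _.
  by rewrite half0 /= exprn_ile1 ?invr_ge0 // invf_le1 // ler1n.
rewrite exprVn ler_pdivrMr ?exprn_gt0 // mul1r -natrX ler_nat.
exact: ltn_expl.
Qed.

Definition cps_deriv i (f : cps n v) : cps n v :=
  Cps (fps_deriv_convergent i (cps_valP f)).

End ConvergentPowerSeries.

Section Ideals.
Context {A : comNzRingType}.
Implicit Types (S I J : set A).

Definition ideal_gen S : set A := [set x | exists s : seq (A * A),
  (forall p, p \in s -> S p.2) /\ x = \sum_(p <- s) p.1 * p.2].

Definition ideal_mul I J : set A := ideal_gen [set x * y | x in I & y in J].

Definition ideal_exp I (k : nat) : set A := iter k (ideal_mul I) setT.

Lemma ideal_gen0 S : ideal_gen S 0.
Proof. by exists [::]; split => //; rewrite big_nil. Qed.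

Lemma ideal_genD S x y : ideal_gen S x -> ideal_gen S y -> ideal_gen S (x + y).
Proof.
move=> [s [Ss ->]] [t [St ->]]; exists (s ++ t); rewrite big_cat; split => // p.
by rewrite mem_cat => /orP[/Ss|/St].
Qed.

Lemma ideal_genMl S a x : ideal_gen S x -> ideal_gen S (a * x).
Proof.
move=> [s [Ss ->]]; exists [seq (a * p.1, p.2) | p <- s]; split.
  by move=> _ /mapP[p /Ss Sp ->].
by rewrite big_map mulr_sumr; apply: eq_bigr => p _; rewrite mulrA.
Qed.

Definition ideal_genp S : pred A := [pred x | `[<ideal_gen S x>]].

Lemma ideal_genp_zmod S : zmod_closed (ideal_genp S).
Proof.
split=> [|x y]; rewrite !inE ?asboolE; first exact: ideal_gen0.
by move=> Sx Sy; rewrite -mulN1r; apply/ideal_genD/ideal_genMl.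
Qed.

HB.instance Definition _ S := GRing.isZmodClosed.Build A (ideal_genp S)
  (ideal_genp_zmod S).

End Ideals.

(* The quotient of A by the ideal generated by S; Quotient.quot is only used for
   the additive group, as its ring structure requires a proper ideal. *)
Definition quo (A : comNzRingType) (S : set A) : Type :=
  Quotient.quot (GRing.ZmodClosed.clone A (ideal_genp S) _).

Section QuotientRing.
Context {A : comNzRingType} (S : set A).

HB.instance Definition _ := GRing.Zmodule.on (quo S).
HB.instance Definition _ := EqQuotient.on (quo S).

Lemma quo_eqP (x y : A) :
  reflect (ideal_gen S (x - y)) (\pi_(quo S) x == \pi_(quo S) y).
Proof.
rewrite (_ : (_ == _) = ((x - y) \in ideal_genp S)); first exact: asboolP.
by rewrite Quotient.idealrBE.
Qed.

Lemma quo_piD : {morph \pi_(quo S) : x y / x + y}.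
Proof.
exact: (raddfD \pi_(Quotient.quot (GRing.ZmodClosed.clone A (ideal_genp S) _))).
Qed.

Definition quo_one : quo S := \pi_(quo S) 1.

Definition quo_mul (x y : quo S) : quo S := \pi_(quo S) (repr x * repr y).

Lemma quo_piM : {morph \pi_(quo S) : x y / x * y >-> quo_mul x y}.
Proof.
move=> x y; apply/eqP/quo_eqP.
set x' := repr _; set y' := repr _.
have xx' : ideal_gen S (x - x') by apply/quo_eqP; rewrite reprK.
have yy' : ideal_gen S (y - y') by apply/quo_eqP; rewrite reprK.
have -> : x * y - x' * y' = y * (x - x') + x' * (y - y').
  by rewrite !mulrBr addrA mulrC [y * x']mulrC subrK.
by apply: ideal_genD; apply: ideal_genMl.
Qed.

Lemma quo_ind (P : quo S -> Prop) : (forall a, P (\pi_(quo S) a)) -> forall x, P x.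
Proof. by move=> Pa x; rewrite -[x]reprK. Qed.

Lemma quo_mulA : associative quo_mul.
Proof.
by elim/quo_ind=> x; elim/quo_ind=> y; elim/quo_ind=> z; rewrite -!quo_piM mulrA.
Qed.

Lemma quo_mulC : commutative quo_mul.
Proof. by elim/quo_ind=> x; elim/quo_ind=> y; rewrite -!quo_piM mulrC. Qed.

Lemma quo_mul1 : left_id quo_one quo_mul.
Proof. by elim/quo_ind=> x; rewrite -quo_piM mul1r. Qed.

Lemma quo_mulDl : left_distributive quo_mul +%R.
Proof.
elim/quo_ind=> x; elim/quo_ind=> y; elim/quo_ind=> z.
by rewrite -quo_piD -!quo_piM mulrDl quo_piD.
Qed.

HB.instance Definition _ := GRing.Zmodule_isComPzRing.Build (quo S)
  quo_mulA quo_mulC quo_mul1 quo_mulDl.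

End QuotientRing.

Section QuotientAlgebra.
Context {K : fieldType} {A : comAlgType K} (S : set A).

Definition quo_scale (a : K) (x : quo S) : quo S := \pi_(quo S) (a *: repr x).

Lemma quo_piZ a : {morph \pi_(quo S) : x / a *: x >-> quo_scale a x}.
Proof.
move=> x; apply/eqP/quo_eqP; set x' := repr _.
have xx' : ideal_gen S (x - x') by apply/quo_eqP; rewrite reprK.
by rewrite -scalerBr -mulr_algl; exact: ideal_genMl.
Qed.

Lemma quo_scaleA a b x : quo_scale a (quo_scale b x) = quo_scale (a * b) x.
Proof. by elim/(@quo_ind A S): x => x; rewrite -!quo_piZ scalerA. Qed.

Lemma quo_scale1 : left_id 1 quo_scale.
Proof. by elim/(@quo_ind A S)=> x; rewrite -quo_piZ scale1r. Qed.

Lemma quo_scaleDr : right_distributive quo_scale +%R.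
Proof.
move=> a; elim/(@quo_ind A S)=> x; elim/(@quo_ind A S)=> y.
by rewrite -quo_piD -!quo_piZ scalerDr quo_piD.
Qed.

Lemma quo_scaleDl x : {morph quo_scale^~ x : a b / a + b}.
Proof.
by elim/(@quo_ind A S): x => x a b; rewrite -!quo_piZ scalerDl quo_piD.
Qed.

HB.instance Definition _ := GRing.Zmodule_isLmodule.Build K (quo S)
  quo_scaleA quo_scale1 quo_scaleDr quo_scaleDl.

End QuotientAlgebra.

(* A quotient may be the zero ring, hence is not an algType; a morphism of
   K-algebras is therefore spelled out as a linear ring morphism. *)
Definition alg_iso (K : fieldType) (A : comAlgType K) (S S' : set A)
    (phi : quo S -> quo S') : Prop :=
  [/\ bijective phi, linear phi & monoid_morphism phi].

(* The infimum of the empty set is +oo, and all finite bases have the same size. *)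
Definition kdim (R : realType) (K : fieldType) (V : lmodType K) : \bar R :=
  ereal_inf [set d%:R%:E | d in [set d : nat | exists b : 'I_d -> V,
    forall x, exists! c : {ffun 'I_d -> K}, x = \sum_(i < d) c i *: b i]].

Section Singularities.
Context {n : nat} {R : realType} {K : fieldType} {v : absValue R K}.
Implicit Types (f g : cps n v) (k : nat).

Definition maxideal : set (cps n v) := ideal_gen (range cps_var).

(* The supremum is a maximum unless f = 0, in which case it is +oo. *)
Definition cps_ord f : \bar R :=
  ereal_sup [set l%:R%:E | l in [set l : nat | ideal_exp maxideal l f]].

Definition jacobian_ideal f : set (cps n v) := ideal_gen (range (cps_deriv ^~ f)).

Definition milnor_number f : \bar R := kdim R (quo (jacobian_ideal f)).

Definition tjurina_number f : \bar R := kdim R (quo (f |` jacobian_ideal f)).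

Definition tjurina_rels k f : set (cps n v) :=
  f |` ideal_mul (ideal_exp maxideal k) (jacobian_ideal f).

Definition milnor_rels k f : set (cps n v) :=
  ideal_mul (ideal_exp maxideal k) (jacobian_ideal f).

(* A ring automorphism automatically preserves the maximal ideal; the condition
   only records that the automorphism is one of local algebras. *)
Definition local_aut (phi : {lrmorphism cps n v -> cps n v}) : Prop :=
  bijective phi /\ (forall h, maxideal h -> maxideal (phi h)).

Definition right_equiv f g : Prop :=
  exists2 phi : {lrmorphism cps n v -> cps n v}, local_aut phi & f = phi g.

Definition contact_equiv f g : Prop :=
  exists2 phi : {lrmorphism cps n v -> cps n v}, local_aut phi &
  exists2 u, u \is a GRing.unit & f = u * phi g.

Definition tjurina_iso k f g : Prop :=
  exists phi : quo (tjurina_rels k f) -> quo (tjurina_rels k g), alg_iso phi.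

(* t acts on the k-th Milnor algebra of f (resp. g) as f (resp. g), so that an
   isomorphism of K{t}-algebras is one of K-algebras mapping the class of f to
   that of g. *)
Definition milnor_iso k f g : Prop :=
  exists2 phi : quo (milnor_rels k f) -> quo (milnor_rels k g),
    alg_iso phi & phi (\pi_(quo (milnor_rels k f)) f) = \pi_(quo (milnor_rels k g)) g.

End Singularities.

(* Main.v *)
From HB Require Import structures.
Require Import Defs.
From mathcomp Require Import all_boot all_order all_algebra.
From mathcomp Require Import mpoly.
From mathcomp Require Import all_classical all_reals.
From mathcomp Require Import ereal.
From mathcomp Require Import zify ring lra.

(* A K-algebra isomorphism T_k(f) -> T_k(g) lifts to an automorphism of K{x}, which
   reduces the hard direction to the case <f, m^k j(f)> = <g, m^k j(g)>; comparing
   orders, a unit multiple of g then differs from f by some h in m^D, D = 2 tau - ord f + 3,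
   so that it suffices to solve (1 + w) f(x + y) = f + h.  Put a = tau - ord f + 3.  Nakayama's lemma gives
   m^tau <= <f, j(f)>, hence m^D = m^(a + tau) <= m^a <f, j(f)>.  Splitting off the
   terms of f(x + y) that are linear in y turns the equation into a fixed-point
   problem for (w, y) in m^a, contracting for the m-adic topology because the
   remainder is quadratic.  K need not be complete: the iteration converges
   coefficientwise in K[[x]], and weighted norms bounded along the iteration stay
   bounded in the limit, which is therefore convergent.  The same principle inverts
   units and near-identity substitutions.  Right equivalence is the case w = 0,
   with mu and j(f) instead of tau and <f, j(f)>. *)

Set Implicit Arguments.
Unset Strict Implicit.
Unset Printing Implicit Defensive.
Import Order.TTheory GRing.Theory Num.Theory.
Local Open Scope ring_scope.

(** * Formal power series and their order *)

(** The characteristic of K is arbitrary, so factorials cannot be inverted: the Taylor remainder of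
    f(x + y) is defined by subtraction, and its quadratic size is proved by recursion along the
    division by the variables. The same recursion replaces continuity wherever morphisms or
    derivations of K{x} are compared. The bound on k is an order count: the error h lies in m^k
    j(f), hence has order at least k + ord f - 1, and this reaches D = 2 tau - ord f + 3 exactly
    when k >= 2(tau - ord f + 2). The lift of an isomorphism is bijective because the ideal <f, m^k
    j(f)> lies in m^2, so that linear parts survive in the quotient. If f = 0, its order is infinite
    and every k is admissible; finite codimension then forces m = 0. *)

Section FormalSeries.
Context {n : nat} {K : fieldType}.
Implicit Types (f g h : fps n K) (m : 'X_{1..n}) (i j : 'I_n) (N : nat).

Lemma fpsD f g m : (f + g) m = f m + g m. Proof. by []. Qed.
Lemma fpsN f m : (- f) m = - f m. Proof. by []. Qed.
Lemma fpsZ (a : K) f m : (a *: f) m = a * f m. Proof. by []. Qed.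
Lemma fps1 m : (1 : fps n K) m = (m == 0%MM)%:R. Proof. by []. Qed.

Lemma fps_sum (I : Type) (r : seq I) (P : pred I) (F : I -> fps n K) m :
  (\sum_(i <- r | P i) F i) m = \sum_(i <- r | P i) F i m.
Proof. by elim/big_rec2: _ => // i y x _ <-. Qed.

Lemma fpsM f g m : (f * g) m =
  \sum_(k : 'X_{1..n < (mdeg m).+1} | (k <= m)%MM) f k * g (m - k)%MM.
Proof. by []. Qed.

Lemma mdeg_sub m m' : (m' <= m)%MM -> mdeg m = (mdeg m' + mdeg (m - m'))%N.
Proof. by move=> le; rewrite -mdegD addmC submK. Qed.

Lemma fps_varM j f m : (fps_var j * f) m = if m j == 0%N then 0 else f (m - U_(j))%MM.
Proof.
rewrite fpsM; case: ifPn => mj.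
  rewrite big1 // => k km; rewrite /fps_var; case: eqP => [kE|]; last by rewrite mul0r.
  by move: km; rewrite kE lep1mP mj.
have le1 : (U_(j) <= m)%MM by rewrite lep1mP.
have md : (mdeg U_(j)%MM < (mdeg m).+1)%N by rewrite (mdeg_sub le1) ltnS leq_addr.
rewrite (bigD1 (BMultinom md)) //= big1 ?addr0; first by rewrite /fps_var eqxx mul1r.
move=> k /andP[_]; rewrite -val_eqE /= /fps_var => /negbTE ->.
by rewrite mul0r.
Qed.

(** A predicate instead of an order function: the zero series needs no special case, and formal and
    convergent series are treated alike. On convergent series it is membership in m^N
    ([ideal_exp_maxP]). *)
Definition ordge N f := forall m, (mdeg m < N)%N -> f m = 0.

Lemma ordge_trivial f : ordge 0 f. Proof. by []. Qed.

Lemma ordgeW N N' f : (N' <= N)%N -> ordge N f -> ordge N' f.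
Proof. by move=> le fN m mN'; apply/fN/(leq_trans mN'). Qed.

Lemma ordgeD N f g : ordge N f -> ordge N g -> ordge N (f + g).
Proof. by move=> fN gN m mN; rewrite fpsD fN // gN // addr0. Qed.

Lemma ordgeN N f : ordge N f -> ordge N (- f).
Proof. by move=> fN m mN; rewrite fpsN fN // oppr0. Qed.

Lemma ordgeB N f g : ordge N f -> ordge N g -> ordge N (f - g).
Proof. by move=> fN /ordgeN; exact: ordgeD. Qed.

Lemma ordgeZ N (a : K) f : ordge N f -> ordge N (a *: f).
Proof. by move=> fN m mN; rewrite fpsZ fN // mulr0. Qed.

Lemma ordge_sum (I : Type) (r : seq I) (P : pred I) (F : I -> fps n K) N :
  (forall k, P k -> ordge N (F k)) -> ordge N (\sum_(k <- r | P k) F k).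
Proof. by move=> FN; elim/big_ind: _ => //; exact: ordgeD. Qed.

Lemma ordgeM a b f g : ordge a f -> ordge b g -> ordge (a + b) (f * g).
Proof.
move=> fa gb m; rewrite fpsM => mab; apply: big1 => k km.
have [/fa->|ka] := ltnP (mdeg k) a; first by rewrite mul0r.
by rewrite gb ?mulr0 //; have := mdeg_sub km; lia.
Qed.

Lemma ordgeMl N f g : ordge N g -> ordge N (f * g).
Proof. by rewrite -{2}[N]add0n; apply: ordgeM. Qed.

Lemma ordgeMr N f g : ordge N f -> ordge N (f * g).
Proof. by rewrite mulrC; exact: ordgeMl. Qed.

Lemma ordgeX a f k : ordge a f -> ordge (a * k) (f ^+ k).
Proof.
move=> fa; elim: k => [|k IH]; first by rewrite muln0.
by rewrite exprS mulnS; exact: ordgeM.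
Qed.

Lemma ordge_eq0 f : (forall N, ordge N f) -> f = 0.
Proof. by move=> fN; apply/funext => m; apply: (fN (mdeg m).+1). Qed.

Lemma ordge_eq N f g : ordge N (f - g) <-> forall m, (mdeg m < N)%N -> f m = g m.
Proof.
split=> fg m mN; last by rewrite fpsD fpsN fg // subrr.
by apply/eqP; rewrite -subr_eq0; apply/eqP/fg.
Qed.

Lemma ordge_var j : ordge 1 (fps_var j : fps n K).
Proof.
move=> m; rewrite ltnS leqn0 /fps_var mdeg_eq0 => /eqP->.
by rewrite eq_sym mnm1_eq0.
Qed.

(* Each monomial of positive degree is divided by the first variable occurring in it,
   which makes the division by the variables linear. *)
Definition fdiv j f : fps n K := fun m =>
  if [forall i : 'I_n, (i < j)%N ==> (m i == 0%N)] then f (m + U_(j))%MM else 0.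

Lemma fps_decomp f : f = (f 0%MM)%:A + \sum_j fps_var j * fdiv j f.
Proof.
apply/funext => m; rewrite fpsD fpsZ fps1 fps_sum.
have [->|m0] := eqVneq m 0%MM.
  rewrite mulr1 big1 ?addr0 // => j _.
  by rewrite fps_varM mnm0E eqxx.
rewrite mulr0 add0r.
have [i0 mi0] : exists i, m i != 0%N.
  apply/existsP; rewrite -negb_forall; apply: contra m0 => /forallP m0.
  by apply/eqP/mnmP => i; rewrite mnm0E; apply/eqP.
have [j mj jmin] := @arg_minnP _ i0 (fun i => m i != 0%N) (fun i => val i) mi0.
rewrite (bigD1 j) //= big1 ?addr0 => [|k kj].
  rewrite fps_varM (negbTE mj) /fdiv submK ?lep1mP //.
  case: forallP => // -[] i; apply/implyP => ij.
  rewrite mnmBE; case: (eqVneq (m i) 0%N) => [->//|/jmin/=].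
  by rewrite leqNgt ij.
rewrite fps_varM; case: ifPn => // mk; rewrite /fdiv.
case: forallP => // /(_ j)/implyP; rewrite mnmBE mnm1E (negbTE kj) subn0 (negbTE mj).
have /= := jmin _ mk; rewrite leq_eqVlt => /orP[/eqP/val_inj jk|kj'].
  by rewrite jk eqxx in kj.
by move=> /(_ kj').
Qed.

Lemma fdivB j : {morph fdiv j : f g / f - g}.
Proof.
move=> f g; apply/funext => m; rewrite fpsD fpsN /fdiv.
by case: ifP => //; rewrite subr0.
Qed.

Lemma ordge_fdiv N j f : ordge N.+1 f -> ordge N (fdiv j f).
Proof.
by move=> fN m mN; rewrite /fdiv fN ?if_same // mdegD mdeg1 addn1 ltnS.
Qed.

Lemma ordge1P f : ordge 1 f <-> f 0%MM = 0.
Proof.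
split=> [->//|f0 m]; first by rewrite mdeg0.
by rewrite ltnS leqn0 mdeg_eq0 => /eqP->.
Qed.

Lemma ordge_decomp f : ordge 1 f -> f = \sum_j fps_var j * fdiv j f.
Proof. by move=> /ordge1P f0; rewrite {1}[f]fps_decomp f0 scale0r add0r. Qed.

(** Every use of the recursion gains one order from the factors [u j], until the order [b] of the
    defect is reached. The type [T] is arbitrary so that the argument may be a formal or a
    convergent series. *)
Lemma rec_ordge (T : Type) (dv : 'I_n -> T -> T) (E : T -> fps n K)
    (u : 'I_n -> fps n K) b :
    (forall j, ordge 1 (u j)) ->
    (forall t, ordge b (E t - \sum_j u j * E (dv j t))) ->
  forall t, ordge b (E t).
Proof.
move=> u1 EE; suff H N t : (N <= b)%N -> ordge N (E t) by move=> t; exact: H.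
elim: N t => // N IH t Nb.
rewrite -[E t](subrK (\sum_j u j * E (dv j t))).
apply: ordgeD; first exact: ordgeW (EE t).
by apply: ordge_sum => j _; rewrite -add1n; apply: ordgeM => //; apply/IH/ltnW.
Qed.

(* Stands in for Krull's intersection theorem: two maps satisfying the same recursion
   along the division by the variables are equal. *)
Lemma rec_eq0 (T : Type) (dv : 'I_n -> T -> T) (E : T -> fps n K)
    (u : 'I_n -> fps n K) :
    (forall j, ordge 1 (u j)) -> (forall t, E t = \sum_j u j * E (dv j t)) ->
  forall t, E t = 0.
Proof.
move=> u1 EE t; apply: ordge_eq0 => N.
by apply: (rec_ordge (u := u) (dv := dv)) => // {}t; rewrite {1}EE subrr.
Qed.

Lemma fps_derivD i f g : fps_deriv i (f + g) = fps_deriv i f + fps_deriv i g.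
Proof. by apply/funext => m; rewrite fpsD /fps_deriv fpsD mulrnDl. Qed.

Lemma fps_derivZ i (a : K) f : fps_deriv i (a *: f) = a *: fps_deriv i f.
Proof. by apply/funext => m; rewrite fpsZ /fps_deriv fpsZ mulrnAr. Qed.

Lemma fps_deriv1 i : fps_deriv i (1 : fps n K) = 0.
Proof.
apply/funext => m; rewrite /fps_deriv fps1 addmC mnmD_eq0 mnm1_eq0 /=.
by rewrite mul0rn.
Qed.

Lemma fps_deriv_varM i j f :
  fps_deriv i (fps_var j * f) = (i == j)%:R *: f + fps_var j * fps_deriv i f.
Proof.
apply/funext => m; rewrite fpsD fpsZ /fps_deriv !fps_varM mnmDE mnm1E.
case: (eqVneq i j) => [->|ij]; rewrite ?mul1r ?mul0r ?add0r.
  rewrite addn1 /= addmK; case: (eqVneq (m j) 0%N) => [->|mj]; first by rewrite addr0.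
  rewrite submK ?lep1mP // mnmBE mnm1E eqxx.
  by rewrite -mulrS; congr (_ *+ _); lia.
rewrite addn0; case: (eqVneq (m j) 0%N) => [_|mj]; first by rewrite mul0rn.
rewrite mnmBE mnm1E eq_sym (negbTE ij) subn0; congr (f _ *+ _).
by rewrite [(_ - _ + _)%MM]addmC addmBA ?lep1mP // addmC.
Qed.

Lemma ordge_deriv N i f : ordge N.+1 f -> ordge N (fps_deriv i f).
Proof.
by move=> fN m mN; rewrite /fps_deriv fN ?mul0rn // mdegD mdeg1 addn1 ltnS.
Qed.

(** With g fixed, the defect of the Leibniz rule is additive in f, vanishes on constants and
    commutes with multiplication by a variable; [rec_eq0] makes it zero. *)
Lemma fps_derivM i f g :
  fps_deriv i (f * g) = fps_deriv i f * g + f * fps_deriv i g.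
Proof.
apply/eqP; rewrite -subr_eq0; apply/eqP; move: f.
apply: (rec_eq0 (dv := fdiv) (u := fps_var)) => [j|f]; first exact: ordge_var.
pose E f := fps_deriv i (f * g) - (fps_deriv i f * g + f * fps_deriv i g).
have ED f1 f2 : E (f1 + f2) = E f1 + E f2.
  by rewrite /E mulrDl !fps_derivD !mulrDl; ring.
have E1 (a : K) : E a%:A = 0.
  by rewrite /E -!scalerAl !fps_derivZ fps_deriv1 -scalerAl !mul1r mul0r scaler0 add0r subrr.
rewrite -[LHS]/(E f) -[in RHS]/(E _) {1}[f]fps_decomp ED E1 add0r.
have E0 : E 0 = 0 by have := E1 0; rewrite scale0r.
rewrite (big_morph E ED E0).
apply: eq_bigr => j _; rewrite /E -mulrA !fps_deriv_varM.
by rewrite mulrDl -scalerAl; ring.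
Qed.

End FormalSeries.

(** * Substitution *)

Section BoundedMultinomials.
Context {n : nat}.
Implicit Types (m : 'X_{1..n}) (s : seq 'X_{1..n}).

Definition bms (d : nat) : seq 'X_{1..n} := [seq bmnm k | k <- index_enum 'X_{1..n < d}].

Lemma mem_bms d m : (m \in bms d) = (mdeg m < d)%N.
Proof.
apply/mapP/idP => [[k _ ->]|md]; first exact: bmdeg.
by exists (BMultinom md); rewrite ?mem_index_enum.
Qed.

Lemma bms_uniq d : uniq (bms d).
Proof. by rewrite map_inj_uniq ?index_enum_uniq //; exact: val_inj. Qed.

Lemma big_bms (V : nmodType) d (P : pred 'X_{1..n}) (F : 'X_{1..n} -> V) :
  \sum_(k : 'X_{1..n < d} | P k) F k = \sum_(m <- bms d | P m) F m.
Proof. by rewrite /bms big_map. Qed.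

Lemma eq_sum_subseq (V : nmodType) s s' (F : 'X_{1..n} -> V) :
    uniq s -> uniq s' -> {subset s' <= s} ->
    (forall m, m \in s -> m \notin s' -> F m = 0) ->
  \sum_(m <- s) F m = \sum_(m <- s') F m.
Proof.
move=> us us' ss' F0; rewrite (bigID (mem s')) /= [X in _ + X]big_seq_cond.
rewrite [X in _ + X]big1 ?addr0 => [|m /andP[ms ms']]; last exact: F0.
rewrite -big_filter; apply/perm_big/uniq_perm; rewrite ?filter_uniq // => m.
rewrite mem_filter /=; apply/andP/idP => [[]//|ms']; by split=> //; exact: ss'.
Qed.

Lemma ler_sum_subseq (R : numDomainType) s s' (F : 'X_{1..n} -> R) :
    uniq s -> uniq s' -> {subset s' <= s} -> (forall m, 0 <= F m) ->
  \sum_(m <- s') F m <= \sum_(m <- s) F m.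
Proof.
move=> us us' ss' F0; rewrite [leRHS](bigID (mem s')) /=.
rewrite -[leLHS]addr0 lerD ?sumr_ge0 // -[leRHS]big_filter.
rewrite le_eqVlt; apply/orP; left; apply/eqP/perm_big/uniq_perm; rewrite ?filter_uniq //.
move=> m; rewrite mem_filter /=; apply/idP/andP => [ms'|[]//].
by split=> //; exact: ss'.
Qed.

Lemma bms_widen d d' : (d <= d')%N -> {subset bms d <= bms d'}.
Proof. by move=> dd' m; rewrite !mem_bms => /leq_trans; apply. Qed.

Lemma eq_sum_bms (V : nmodType) d d' (F : 'X_{1..n} -> V) : (d <= d')%N ->
    (forall m, (d <= mdeg m)%N -> F m = 0) ->
  \sum_(m <- bms d') F m = \sum_(m <- bms d) F m.
Proof.
move=> dd' F0; apply: eq_sum_subseq; rewrite ?bms_uniq //; first exact: bms_widen.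
by move=> m _; rewrite mem_bms -leqNgt; exact: F0.
Qed.

End BoundedMultinomials.

Section Substitution.
Context {n : nat} {K : fieldType}.
Implicit Types (f g h : fps n K) (m : 'X_{1..n}) (i j : 'I_n) (u w : 'I_n -> fps n K).

Lemma fpsM_bms d f g m : (mdeg m < d)%N ->
  (f * g) m = \sum_(k <- bms d | (k <= m)%MM) f k * g (m - k)%MM.
Proof.
move=> md; rewrite fpsM (big_bms _ (fun k => (k <= m)%MM) (fun k => f k * g (m - k)%MM)).
rewrite big_mkcond [RHS]big_mkcond; apply/esym/eq_sum_bms => //.
by move=> k km; case: ifP => // /mdeg_sub; lia.
Qed.

Lemma mmap1M u m m' : mmap1 u (m + m')%MM = mmap1 u m * mmap1 u m'.
Proof. by apply: commr_mmap1_M => i x; exact: mulrC. Qed.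

Lemma ordge_mmap1 u m : (forall i, ordge 1 (u i)) -> ordge (mdeg m) (mmap1 u m).
Proof.
move=> u1; rewrite mdegE /mmap1.
elim/big_rec2: _ => [|i p N _ pN]; first exact: ordge_trivial.
by apply: ordgeM => //; rewrite -{1}[m i]mul1n; exact: ordgeX.
Qed.

(** When the [u i] have no constant term, [mmap1 u k] has order at least [mdeg k], so the monomials
    left out cannot reach the coefficient of m: the finite sum is the true composition f(u)
    ([fsubE]). *)
Definition fsub u f : fps n K :=
  fun m => \sum_(k <- bms (mdeg m).+1) f k * mmap1 u k m.

Lemma fsubE u d f m : (forall i, ordge 1 (u i)) -> (mdeg m < d)%N ->
  fsub u f m = \sum_(k <- bms d) f k * mmap1 u k m.
Proof.
move=> u1 md; rewrite /fsub; apply/esym/eq_sum_bms => // k km.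
by rewrite (ordge_mmap1 u1) ?mulr0.
Qed.

Lemma fsub_trunc u d f : (forall i, ordge 1 (u i)) ->
  ordge d (fsub u f - \sum_(k <- bms d) f k *: mmap1 u k).
Proof. by move=> u1; apply/ordge_eq => m md; rewrite (fsubE _ u1 md) fps_sum. Qed.

Lemma fsubD u f g : fsub u (f + g) = fsub u f + fsub u g.
Proof.
apply/funext => m; rewrite fpsD /fsub -big_split; apply: eq_bigr => k _.
by rewrite fpsD mulrDl.
Qed.

Lemma fsubZ u (a : K) f : fsub u (a *: f) = a *: fsub u f.
Proof.
apply/funext => m; rewrite fpsZ /fsub mulr_sumr; apply: eq_bigr => k _.
by rewrite fpsZ mulrA.
Qed.

Lemma fsub_zero u : fsub u 0 = 0.
Proof. by apply/funext => m; rewrite /fsub big1 // => k _; rewrite mul0r. Qed.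

Lemma fsubN u f : fsub u (- f) = - fsub u f.
Proof. by rewrite -scaleN1r fsubZ scaleN1r. Qed.

Lemma fsubB u f g : fsub u (f - g) = fsub u f - fsub u g.
Proof. by rewrite fsubD fsubN. Qed.

Lemma fsub_sum u (I : Type) (r : seq I) (P : pred I) (F : I -> fps n K) :
  fsub u (\sum_(k <- r | P k) F k) = \sum_(k <- r | P k) fsub u (F k).
Proof. exact: (big_morph _ (fsubD u) (fsub_zero u)). Qed.

Lemma fsub1 u : fsub u 1 = 1.
Proof.
apply/funext => m; rewrite /fsub (@eq_sum_subseq _ _ _ [:: 0%MM]) ?bms_uniq //.
- by rewrite big_seq1 fps1 eqxx mul1r mmap11.
- by move=> k; rewrite inE mem_bms => /eqP->; rewrite mdeg0.
- by move=> k _; rewrite inE fps1 => /negbTE->; rewrite mul0r.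
Qed.

Lemma ordge_fsub u N f : (forall i, ordge 1 (u i)) -> ordge N f -> ordge N (fsub u f).
Proof.
move=> u1 fN m mN; rewrite /fsub big_seq big1 // => k; rewrite mem_bms => km.
by rewrite fN ?mul0r //; lia.
Qed.

Lemma fsub_varM u j f : (forall i, ordge 1 (u i)) ->
  fsub u (fps_var j * f) = u j * fsub u f.
Proof.
move=> u1; apply/funext => m; set d := (mdeg m).+1.
transitivity ((u j * \sum_(k <- bms d) f k *: mmap1 u k) m); last first.
  apply: (proj1 (ordge_eq d _ _)) => //.
  rewrite -mulrBr -opprB mulrN; apply/ordgeN/ordgeMl.
  exact: fsub_trunc.
(* One degree more than m requires, because multiplication by the variable shifts the monomials of
   degree below d by one. *)
rewrite (@fsubE _ d.+1) ?/d // mulr_sumr fps_sum.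
transitivity (\sum_(k <- [seq (k + U_(j))%MM | k <- bms d])
                (fps_var j * f) k * mmap1 u k m).
  apply: eq_sum_subseq; rewrite ?(map_inj_uniq (@addIm _ _)) ?bms_uniq //.
  - by move=> _ /mapP[k + ->]; rewrite !mem_bms mdegD mdeg1; lia.
  - move=> k; rewrite mem_bms fps_varM => kd; case: eqVneq => [|kj kn].
      by rewrite mul0r.
    case/negP: kn; apply/mapP; exists (k - U_(j))%MM; last by rewrite submK ?lep1mP.
    have le1 : (U_(j) <= k)%MM by rewrite lep1mP.
    by rewrite mem_bms; have := mdeg_sub le1; rewrite mdeg1; lia.
rewrite big_map; apply: eq_bigr => k _.
rewrite fps_varM mnmDE mnm1E eqxx addn1 /= addmK mmap1M mmap1U.
by rewrite -scalerAr fpsZ [u j * _]mulrC.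
Qed.

End Substitution.

Section SubstitutionMorphism.
Context {n : nat} {K : fieldType}.
Implicit Types (f g h : fps n K) (m : 'X_{1..n}) (i j : 'I_n).
Implicit Types (u w y : 'I_n -> fps n K).

Lemma fsub_rec u f : (forall i, ordge 1 (u i)) ->
  fsub u f = (f 0%MM)%:A + \sum_j u j * fsub u (fdiv j f).
Proof.
move=> u1; rewrite {1}[f]fps_decomp fsubD fsubZ fsub1 fsub_sum.
by congr (_ + _); apply: eq_bigr => j _; rewrite fsub_varM.
Qed.

Lemma fsub_var u j : (forall i, ordge 1 (u i)) -> fsub u (fps_var j) = u j.
Proof. by move=> u1; rewrite -[fps_var j]mulr1 fsub_varM // fsub1 mulr1. Qed.

Lemma fsub_id f : fsub fps_var f = f.
Proof.
apply/eqP; rewrite -subr_eq0; apply/eqP; move: f.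
apply: (rec_eq0 (dv := fdiv) (u := fps_var)) => [j|f]; first exact: ordge_var.
rewrite fsub_rec; last exact: ordge_var.
rewrite [X in _ - X]fps_decomp opprD addrACA subrr add0r -sumrB.
by apply: eq_bigr => j _; rewrite mulrBr.
Qed.

Lemma fsubM u f g : (forall i, ordge 1 (u i)) -> fsub u (f * g) = fsub u f * fsub u g.
Proof.
move=> u1; apply/eqP; rewrite -subr_eq0; apply/eqP; move: f.
apply: (rec_eq0 (dv := fdiv) (u := u)) => // f.
rewrite (fsub_rec f u1) {1}[f]fps_decomp !mulrDl fsubD !mulr_suml fsub_sum.
rewrite -!scalerAl !mul1r fsubZ opprD addrACA subrr add0r -sumrB.
by apply: eq_bigr => j _; rewrite mulrBr -mulrA fsub_varM // -mulrA.
Qed.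

Lemma fsub_comp u w f : (forall i, ordge 1 (u i)) -> (forall i, ordge 1 (w i)) ->
  fsub w (fsub u f) = fsub (fun i => fsub w (u i)) f.
Proof.
move=> u1 w1; have uw1 i : ordge 1 (fsub w (u i)) by exact: ordge_fsub.
apply/eqP; rewrite -subr_eq0; apply/eqP; move: f.
apply: (rec_eq0 (dv := fdiv) uw1) => f.
rewrite [fsub u f]fsub_rec // [X in _ - X]fsub_rec // fsubD fsubZ fsub1 fsub_sum.
rewrite opprD addrACA subrr add0r -sumrB.
by apply: eq_bigr => j _; rewrite mulrBr fsubM.
Qed.

Lemma fsub_lip0 u w b f : (forall i, ordge 1 (u i)) -> (forall i, ordge 1 (w i)) ->
  (forall i, ordge b (u i - w i)) -> ordge b (fsub u f - fsub w f).
Proof.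
move=> u1 w1 uwb; move: f.
apply: (rec_ordge (dv := fdiv) u1) => f.
rewrite (fsub_rec f u1) (fsub_rec f w1) [in X in ordge _ X]opprD addrACA subrr add0r.
rewrite -!sumrB; apply: ordge_sum => j _.
rewrite (_ : _ - _ = (u j - w j) * fsub w (fdiv j f)); last by ring.
exact: ordgeMr.
Qed.

(** A mean value estimate: for f = sum x_j f_j the difference is the sum of u_j (f_j(u) - f_j(w)) +
    (u_j - w_j) f_j(w). Changing one factor by order b leaves o further factors of positive
    order. *)
Lemma fsub_lip u w b o f : (forall i, ordge 1 (u i)) -> (forall i, ordge 1 (w i)) ->
  (forall i, ordge b (u i - w i)) -> ordge o.+1 f ->
  ordge (o + b) (fsub u f - fsub w f).
Proof.
move=> u1 w1 uwb; elim: o f => [|o IH] f fo; first exact: fsub_lip0.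
rewrite (fsub_rec f u1) (fsub_rec f w1) [in X in ordge _ X]opprD addrACA subrr add0r.
rewrite -sumrB; apply: ordge_sum => j _.
rewrite (_ : _ - _ = u j * (fsub u (fdiv j f) - fsub w (fdiv j f)) +
  (u j - w j) * fsub w (fdiv j f)); last by ring.
apply: ordgeD.
  by rewrite addSn -add1n; apply: ordgeM => //; apply/IH/ordge_fdiv.
by rewrite addnC; apply: ordgeM => //; apply/ordge_fsub/ordge_fdiv.
Qed.

Definition flin u y f := \sum_i fsub u (fps_deriv i f) * y i.

Definition taylor u y f := fsub (fun i => u i + y i) f - fsub u f - flin u y f.

Lemma flinD u y f g : flin u y (f + g) = flin u y f + flin u y g.
Proof.
rewrite /flin -big_split; apply: eq_bigr => i _.
by rewrite fps_derivD fsubD mulrDl.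
Qed.

Lemma flinZ u y (a : K) f : flin u y (a *: f) = a *: flin u y f.
Proof.
rewrite /flin scaler_sumr; apply: eq_bigr => i _.
by rewrite fps_derivZ fsubZ scalerAl.
Qed.

Lemma flin1 u y : flin u y 1 = 0.
Proof. by rewrite /flin big1 // => i _; rewrite fps_deriv1 fsub_zero mul0r. Qed.

Lemma flin_varM u y j f : (forall i, ordge 1 (u i)) ->
  flin u y (fps_var j * f) = y j * fsub u f + u j * flin u y f.
Proof.
move=> u1; rewrite /flin mulr_sumr.
under eq_bigr => i _ do rewrite fps_deriv_varM fsubD fsubZ fsub_varM // mulrDl.
rewrite big_split /=; congr (_ + _).
  rewrite (bigD1 j) //= eqxx scale1r big1 ?addr0 1?mulrC // => i ij.
  by rewrite (negbTE ij) scale0r mul0r.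
by apply: eq_bigr => i _; rewrite mulrA.
Qed.

Lemma ordge_flin u y o b f : (forall i, ordge 1 (u i)) -> (forall i, ordge b (y i)) ->
  ordge o.+1 f -> ordge (o + b) (flin u y f).
Proof.
move=> u1 yb fo; apply: ordge_sum => i _; apply: ordgeM => //.
by apply: ordge_fsub => //; exact: ordge_deriv.
Qed.

Lemma taylorD u y f g : taylor u y (f + g) = taylor u y f + taylor u y g.
Proof. by rewrite /taylor !fsubD flinD; ring. Qed.

Lemma taylorZ u y (a : K) f : taylor u y (a *: f) = a *: taylor u y f.
Proof. by rewrite /taylor !fsubZ flinZ !scalerBr. Qed.

Lemma taylor1 u y : taylor u y 1 = 0.
Proof. by rewrite /taylor !fsub1 flin1 subrr subr0. Qed.

(** This product rule drives all estimates of the remainder: its first term is treated by recursion,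
    the second is already quadratic in y, since [flin] is linear in y. *)
Lemma taylor_varM u y j f : (forall i, ordge 1 (u i)) -> (forall i, ordge 1 (y i)) ->
  taylor u y (fps_var j * f) = (u j + y j) * taylor u y f + y j * flin u y f.
Proof.
move=> u1 y1; rewrite /taylor !fsub_varM // ?flin_varM //; first by ring.
by move=> i; exact: ordgeD.
Qed.

Lemma taylor_rec u y f : (forall i, ordge 1 (u i)) -> (forall i, ordge 1 (y i)) ->
  taylor u y f =
  \sum_j ((u j + y j) * taylor u y (fdiv j f) + y j * flin u y (fdiv j f)).
Proof.
move=> u1 y1; rewrite {1}[f]fps_decomp taylorD taylorZ taylor1 scaler0 add0r.
have t0 : taylor u y 0 = 0 by have := taylorZ u y 0 0; rewrite !scale0r.
rewrite (big_morph _ (taylorD u y) t0).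
by apply: eq_bigr => j _; rewrite taylor_varM.
Qed.

Lemma ordge_taylor0 u y b f : (0 < b)%N ->
  (forall i, ordge 1 (u i)) -> (forall i, ordge b (y i)) -> ordge (b + b) (taylor u y f).
Proof.
move=> b0 u1 yb; have y1 i : ordge 1 (y i) by exact: ordgeW (yb i).
have uy1 i : ordge 1 (u i + y i) by exact: ordgeD.
move: f; apply: (rec_ordge (dv := fdiv) uy1) => f.
rewrite taylor_rec // -sumrB; apply: ordge_sum => j _.
rewrite addrAC subrr add0r; apply: ordgeM => //.
by apply: ordge_sum => i _; apply: ordgeMl.
Qed.

Lemma ordge_taylor u y b o f : (0 < b)%N ->
  (forall i, ordge 1 (u i)) -> (forall i, ordge b (y i)) ->
  ordge o.+2 f -> ordge (o + b + b) (taylor u y f).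
Proof.
move=> b0 u1 yb; have y1 i : ordge 1 (y i) by exact: ordgeW (yb i).
elim: o f => [|o IH] f fo; first exact: ordge_taylor0.
rewrite taylor_rec //; apply: ordge_sum => j _; apply: ordgeD.
  rewrite !addSn -add1n; apply: ordgeM; first exact: ordgeD.
  by apply/IH/ordge_fdiv.
rewrite addnC; apply: ordgeM => //; apply: ordge_flin => //.
exact: ordge_fdiv.
Qed.

Lemma ordge_taylorB y y' a b o f : (0 < a)%N -> (a <= b)%N ->
  (forall i, ordge a (y i)) -> (forall i, ordge a (y' i)) ->
  (forall i, ordge b (y i - y' i)) -> ordge o.+2 f ->
  ordge (o + a + b) (taylor fps_var y f - taylor fps_var y' f).
Proof.
move=> a0 ab ya y'a yb fo; set X := fps_var.
have X1 i : ordge 1 (X i) by exact: ordge_var.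
have Xy1 i : ordge 1 (X i + y' i).
  by apply: ordgeD => //; exact: ordgeW (y'a i).
pose D i := y i - y' i.
(* Expanding f at x + y' with increment D = y - y' leaves a remainder quadratic in D, plus the
   change of the differential of f between x and x + y', applied to D; [fsub_lip] bounds the
   latter. *)
have -> : taylor X y f - taylor X y' f = taylor (fun i => X i + y' i) D f +
  \sum_i (fsub (fun i => X i + y' i) (fps_deriv i f) - fsub X (fps_deriv i f)) * D i.
  have -> : \sum_i (fsub (fun i => X i + y' i) (fps_deriv i f) -
      fsub X (fps_deriv i f)) * D i =
      flin (fun i => X i + y' i) D f - (flin X y f - flin X y' f).
    rewrite /flin -!sumrB; apply: eq_bigr => i _; rewrite /D; ring.
  rewrite /taylor (_ : (fun i => X i + y' i + D i) = (fun i => X i + y i)).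
    by ring.
  by apply/funext => i; rewrite /D; ring.
apply: ordgeD.
  apply: (@ordgeW _ _ (o + b + b)); first by lia.
  by apply: ordge_taylor => //; exact: leq_trans ab.
apply: ordge_sum => i _; apply: ordgeM; last exact: yb.
apply: fsub_lip => // [j|]; first by rewrite addrAC subrr add0r.
exact: ordge_deriv.
Qed.

End SubstitutionMorphism.

(** * Truncated norms *)

Section TruncatedNorm.
Context {n : nat} {R : realType} {K : fieldType} (v : absValue R K).
Implicit Types (f g h : fps n K) (m : 'X_{1..n}) (i j : 'I_n) (e r s : R) (d : nat).
Implicit Types (u y : 'I_n -> fps n K).

(** A weighted l1 norm with one radius e for all variables, cut off at degree d. The cut-off makes
    it defined on every formal series; a bound uniform in d for some e > 0 amounts to convergence
    ([convergent_nrm]). *)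
Definition nrm d e f : R := \sum_(m <- bms d) v (f m) * e ^+ mdeg m.

Lemma nrm_ge0 d e f : 0 <= e -> 0 <= nrm d e f.
Proof. by move=> e0; apply: sumr_ge0 => m _; rewrite mulr_ge0 ?absv_ge0 ?exprn_ge0. Qed.

Lemma eq_nrm d e f g : ordge d (f - g) -> nrm d e f = nrm d e g.
Proof.
move=> /ordge_eq fg; rewrite /nrm !big_seq; apply: eq_bigr => m.
by rewrite mem_bms => /fg->.
Qed.

Lemma nrm0 d e : nrm d e 0 = 0.
Proof. by apply: big1 => m _; rewrite absv0 mul0r. Qed.

Lemma ler_nrmD d e f g : 0 <= e -> nrm d e (f + g) <= nrm d e f + nrm d e g.
Proof.
move=> e0; rewrite /nrm -big_split /=; apply: ler_sum => m _.
by rewrite -mulrDl ler_wpM2r ?exprn_ge0 // absvD.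
Qed.

Lemma nrmN d e f : nrm d e (- f) = nrm d e f.
Proof. by apply: eq_bigr => m _; rewrite absvN. Qed.

Lemma ler_nrmB d e f g : 0 <= e -> nrm d e (f - g) <= nrm d e f + nrm d e g.
Proof. by move=> e0; rewrite -[nrm d e g]nrmN; exact: ler_nrmD. Qed.

Lemma nrmZ d e (a : K) f : nrm d e (a *: f) = v a * nrm d e f.
Proof. by rewrite /nrm mulr_sumr; apply: eq_bigr => m _; rewrite absvM mulrA. Qed.

Lemma ler_nrm_sum (I : Type) (t : seq I) (P : pred I) (F : I -> fps n K) d e : 0 <= e ->
  nrm d e (\sum_(k <- t | P k) F k) <= \sum_(k <- t | P k) nrm d e (F k).
Proof.
move=> e0; elim/big_rec2: _ => [|k x f _ IH]; first by rewrite nrm0.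
by apply: le_trans (ler_nrmD _ _ _ e0) _; rewrite lerD2l.
Qed.

Lemma ler_nrmM d e f g : 0 <= e -> nrm d e (f * g) <= nrm d e f * nrm d e g.
Proof.
move=> e0; pose a h m := v (h m : K) * e ^+ mdeg m.
have a0 h m : 0 <= a h m by rewrite mulr_ge0 ?absv_ge0 ?exprn_ge0.
apply: (@le_trans _ _ (\sum_(m <- bms d) \sum_(k <- bms d | (k <= m)%MM)
   a f k * a g (m - k)%MM)).
  rewrite /nrm !big_seq; apply: ler_sum => m; rewrite mem_bms => md.
  rewrite (fpsM_bms _ _ md).
  apply: le_trans (ler_wpM2r (exprn_ge0 _ e0) (absv_sum _ _ _ _)) _.
  rewrite mulr_suml; apply: ler_sum => k km.
  by rewrite absvM (mdeg_sub km) exprD mulrACA.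
rewrite (exchange_big_dep xpredT) //= mulr_suml; apply: ler_sum => k _.
rewrite -mulr_sumr; apply: ler_wpM2l; first exact: a0.
rewrite -big_filter -(big_map (fun m => m - k)%MM xpredT (a g)).
apply: ler_sum_subseq => //; rewrite ?bms_uniq //.
  rewrite map_inj_in_uniq ?filter_uniq ?bms_uniq // => m m'.
  rewrite !mem_filter => /andP[km _] /andP[km' _] /(congr1 (+%MM^~ k)).
  by rewrite !submK.
move=> _ /mapP[m + ->]; rewrite mem_filter !mem_bms => /andP[km].
by rewrite (mdeg_sub km); lia.
Qed.

(** The source of smallness: shrinking the radius from e' to e scales a monomial of degree k by (e /
    e')^k, which is at most (e / e')^o once k >= o. *)
Lemma nrm_ord o d e e' f : 0 <= e -> e <= e' -> 0 < e' -> ordge o f ->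
  nrm d e f <= (e / e') ^+ o * nrm d e' f.
Proof.
move=> e0 ee' e'0 fo; rewrite /nrm mulr_sumr; apply: ler_sum => m _.
have [/fo->|om] := ltnP (mdeg m) o; first by rewrite absv0 !mul0r mulr0.
rewrite mulrCA ler_wpM2l ?absv_ge0 //.
have -> : e ^+ mdeg m = (e / e') ^+ mdeg m * e' ^+ mdeg m.
  by rewrite -exprMn divfK // gt_eqF.
rewrite ler_wpM2r ?exprn_ge0 ?(ltW e'0) // ler_wiXn2l //.
  by rewrite divr_ge0 // ltW.
by rewrite ler_pdivrMr // mul1r.
Qed.

Lemma nrm1_le1 d e : nrm d e 1 <= 1.
Proof.
have [d0|d0] := posnP d.
  by rewrite /nrm big_seq big_pred0 // => m; rewrite mem_bms d0 ltn0.
rewrite /nrm (bigD1_seq 0%MM) ?bms_uniq ?mem_bms ?mdeg0 //=.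
rewrite fps1 eqxx absv1 mul1r expr0 big1 ?addr0 // => m m0.
by rewrite fps1 (negbTE m0) absv0 mul0r.
Qed.

Lemma nrm_var d e j : 0 <= e -> nrm d e (fps_var j) <= e.
Proof.
move=> e0; rewrite /nrm (bigID (pred1 U_(j)%MM)) /= [X in _ + X]big1 ?addr0; last first.
  by move=> m /negbTE mj; rewrite /fps_var mj absv0 mul0r.
have [jd|jd] := boolP (U_(j)%MM \in bms d); last first.
  rewrite big_seq_cond big_pred0 // => m.
  by apply: contraNF jd => /andP[md /eqP <-].
rewrite -big_filter filter_pred1_uniq ?bms_uniq // big_seq1.
by rewrite /fps_var eqxx absv1 mul1r mdeg1 expr1.
Qed.

Lemma nrm_fdiv d e j f : 0 <= e -> nrm d e (fdiv j f) * e <= nrm d.+1 e f.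
Proof.
move=> e0; rewrite /nrm mulr_suml.
apply: (@le_trans _ _ (\sum_(m <- [seq (m + U_(j))%MM | m <- bms d])
   v (f m) * e ^+ mdeg m)).
  rewrite [leRHS]big_map; apply: ler_sum => m _.
  rewrite -mulrA -exprSr mdegD mdeg1 addn1 ler_wpM2r ?exprn_ge0 //.
  by rewrite /fdiv; case: ifP => // _; rewrite absv0 absv_ge0.
apply: ler_sum_subseq; rewrite ?(map_inj_uniq (@addIm _ _)) ?bms_uniq //.
  by move=> _ /mapP[m + ->]; rewrite !mem_bms mdegD mdeg1 addn1.
by move=> m; rewrite mulr_ge0 ?absv_ge0 ?exprn_ge0.
Qed.

Lemma nrm_mmap1 u d e r m : 0 <= e -> 0 <= r -> (forall i, nrm d e (u i) <= r) ->
  nrm d e (mmap1 u m) <= r ^+ mdeg m.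
Proof.
move=> e0 r0 ur; rewrite mdegE /mmap1.
elim/big_rec2: _ => [|i p N _ pN]; first by rewrite expr0 nrm1_le1.
apply: le_trans (ler_nrmM _ _ _ e0) _; rewrite exprD; apply: ler_pM => //.
- exact: nrm_ge0.
- exact: nrm_ge0.
elim: (m i) => [|k IH]; first by rewrite !expr0 nrm1_le1.
rewrite !exprS; apply: le_trans (ler_nrmM _ _ _ e0) _.
by apply: ler_pM => //; exact: nrm_ge0.
Qed.

Definition fmon m : fps n K := mmap1 fps_var m.

Lemma fmon0 : fmon 0%MM = 1. Proof. exact: mmap11. Qed.

Lemma fmonS j m : fmon (U_(j) + m)%MM = fps_var j * fmon m.
Proof. by rewrite /fmon mmap1M mmap1U. Qed.

Lemma mnm_ind (P : 'X_{1..n} -> Prop) :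
  P 0%MM -> (forall j m, P m -> P (U_(j) + m)%MM) -> forall m, P m.
Proof.
move=> P0 PS m; have [N] := ubnP (mdeg m); elim: N m => // N IH m mN.
have [->//|m0] := eqVneq m 0%MM.
have [j mj] : exists i, m i != 0%N.
  apply/existsP; rewrite -negb_forall; apply: contra m0 => /forallP m0.
  by apply/eqP/mnmP => i; rewrite mnm0E; apply/eqP.
have le1 : (U_(j) <= m)%MM by rewrite lep1mP.
rewrite -(submK le1) addmC; apply/PS/IH.
by move: mN; rewrite (mdeg_sub le1) mdeg1.
Qed.

Lemma fps_trunc_fmon d f : ordge d (f - \sum_(m <- bms d) f m *: fmon m).
Proof. by rewrite -{1}[f]fsub_id; apply: fsub_trunc; exact: ordge_var. Qed.

(** For a weighted l1 norm, a linear operator is bounded by its values on the monomials.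
    Preservation of [ordge d] lets the truncated norm of [T f] depend on the truncation of f
    only. *)
Lemma nrm_linop (T : fps n K -> fps n K) d e r (C : R) f : 0 <= e ->
    (forall g h, T (g + h) = T g + T h) -> (forall (a : K) g, T (a *: g) = a *: T g) ->
    (forall g, ordge d g -> ordge d (T g)) ->
    (forall m, nrm d e (T (fmon m)) <= C * r ^+ mdeg m) ->
  nrm d e (T f) <= C * nrm d r f.
Proof.
move=> e0 TD TZ Td Tm; have T0 : T 0 = 0 by have := TZ 0 0; rewrite !scale0r.
have -> : nrm d e (T f) = nrm d e (\sum_(m <- bms d) f m *: T (fmon m)).
  apply: eq_nrm; have := Td _ (@fps_trunc_fmon d f).
  rewrite -scaleN1r TD TZ scaleN1r (big_morph T TD T0).
  by under eq_bigr => m _ do rewrite TZ.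
apply: le_trans (ler_nrm_sum _ _ _ _ e0) _; rewrite /nrm mulr_sumr.
apply: ler_sum => m _; rewrite -/(nrm d e _) nrmZ mulrCA ler_wpM2l ?absv_ge0 //.
Qed.

Lemma nrm_fsub u d e r f : 0 <= e -> 0 <= r -> (forall i, ordge 1 (u i)) ->
  (forall i, nrm d e (u i) <= r) -> nrm d e (fsub u f) <= nrm d r f.
Proof.
move=> e0 r0 u1 ur; rewrite -[leRHS]mul1r; apply: nrm_linop => //.
- exact: fsubD.
- exact: fsubZ.
- by move=> g; exact: ordge_fsub.
elim/mnm_ind => [|j m IH]; first by rewrite fmon0 fsub1 mdeg0 mul1r nrm1_le1.
rewrite fmonS fsub_varM // mdegD mdeg1 exprD expr1 mulrCA.
by apply: le_trans (ler_nrmM _ _ _ e0) _; apply: ler_pM => //; exact: nrm_ge0.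
Qed.

Section TaylorNorm.
Variables (y : 'I_n -> fps n K) (d : nat) (e s : R).
Hypotheses (e0 : 0 <= e) (s0 : 0 <= s) (s1 : s <= 1).
Hypotheses (y1 : forall i, ordge 1 (y i)) (ys : forall i, nrm d e (y i) <= s * e).

Let X1 i : ordge 1 (fps_var i : fps n K). Proof. exact: ordge_var. Qed.
Let Xy1 i : ordge 1 (fps_var i + y i). Proof. exact: ordgeD. Qed.

Let nrm_fmon m : nrm d e (fmon m) <= e ^+ mdeg m.
Proof. by apply: nrm_mmap1 => // i; exact: nrm_var. Qed.

Let nrm_Xy i : nrm d e (fps_var i + y i) <= 2 * e.
Proof.
apply: le_trans (ler_nrmD _ _ _ e0) _; have := nrm_var d i e0.
have : s * e <= 1 * e by rewrite ler_wpM2r.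
by move: (ys i) => *; lra.
Qed.

Lemma nrm_fsubB f :
  nrm d e (fsub (fun i => fps_var i + y i) f - f) <= s * nrm d (3 * e) f.
Proof.
apply: (nrm_linop (T := fun f => fsub (fun i => fps_var i + y i) f - f)) => //.
- by move=> g h; rewrite fsubD; ring.
- by move=> a g; rewrite fsubZ scalerBr.
- by move=> g gd; apply: ordgeB => //; exact: ordge_fsub.
elim/mnm_ind => [|j m IH].
  by rewrite fmon0 fsub1 subrr nrm0 mdeg0 mulr1.
rewrite fmonS fsub_varM // mdegD mdeg1 exprD expr1 mulrA.
set w := fsub _ _ in IH *.
rewrite (_ : _ - _ = (fps_var j + y j) * (w - fmon m) + y j * fmon m); last by ring.
apply: le_trans (ler_nrmD _ _ _ e0) _.
(* The radius 3 * e originates here: x_j + y_j has norm at most 2 * e and y_j at most s * e, and 2 +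
   1 = 3 closes the induction. *)
apply: (@le_trans _ _ (2 * e * (s * (3 * e) ^+ mdeg m) + s * e * (3 * e) ^+ mdeg m)).
  apply: lerD; apply: le_trans (ler_nrmM _ _ _ e0) _.
    by apply: ler_pM => //; exact: nrm_ge0.
  apply: ler_pM => //; try exact: nrm_ge0.
  apply: le_trans (nrm_fmon m) _.
  by rewrite lerXn2r ?nnegrE //; move: e0 => e0'; lra.
by rewrite le_eqVlt; apply/orP; left; apply/eqP; ring.
Qed.

Lemma nrm_flin m : nrm d e (flin fps_var y (fmon m)) <= s * (mdeg m)%:R * e ^+ mdeg m.
Proof.
elim/mnm_ind: m => [|j m IH]; first by rewrite fmon0 flin1 nrm0 mdeg0 mulr0 mul0r.
rewrite fmonS flin_varM // fsub_id mdegD mdeg1 exprD expr1 natrD.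
apply: le_trans (ler_nrmD _ _ _ e0) _.
apply: (@le_trans _ _ (s * e * e ^+ mdeg m + e * (s * (mdeg m)%:R * e ^+ mdeg m))).
  by apply: lerD; apply: le_trans (ler_nrmM _ _ _ e0) _; apply: ler_pM => //;
    try exact: nrm_ge0; exact: nrm_var.
by rewrite le_eqVlt; apply/orP; left; apply/eqP; ring.
Qed.

Lemma nrm_taylor f : nrm d e (taylor fps_var y f) <= s ^+ 2 * nrm d (3 * e) f.
Proof.
apply: nrm_linop => //.
- exact: taylorD.
- exact: taylorZ.
- move=> g gd; apply: ordgeB; last first.
    case: d gd => [|d'] gd; first exact: ordge_trivial.
    by rewrite -addn1; exact: ordge_flin.
  by apply: ordgeB; exact: ordge_fsub.
have e3 : 0 <= 3 * e by exact: mulr_ge0.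
elim/mnm_ind => [|j m IH].
  by rewrite fmon0 taylor1 nrm0 mdeg0 mulr1 sqr_ge0.
rewrite fmonS taylor_varM // mdegD mdeg1 exprD expr1.
apply: le_trans (ler_nrmD _ _ _ e0) _.
apply: (@le_trans _ _ (2 * e * (s ^+ 2 * (3 * e) ^+ mdeg m) +
  s * e * (s * (3 * e) ^+ mdeg m))).
  apply: lerD; apply: le_trans (ler_nrmM _ _ _ e0) _; apply: ler_pM => //;
    try exact: nrm_ge0.
  (* The degree factor produced by differentiation is absorbed in passing from radius e to 3 * e, as
     mdeg m <= 3 ^ mdeg m. *)
  apply: le_trans (nrm_flin m) _; rewrite -mulrA ler_wpM2l // exprMn.
  rewrite ler_wpM2r ?exprn_ge0 // -natrX ler_nat.
  exact/ltnW/ltn_expl.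
by rewrite le_eqVlt; apply/orP; left; apply/eqP; ring.
Qed.

End TaylorNorm.

Lemma convergent_nrm f : convergent v f <->
  exists2 e : R, 0 < e & exists M : R, forall d, nrm d e f <= M.
Proof.
have mw e m : Defs.mweight (fun=> e) m = e ^+ mdeg m.
  by rewrite /Defs.mweight mdegE -prodrXr.
split=> [/convergentP[e e0 fe]|[e e0 [M fM]]].
  (* A single radius below all the [e i]; the default value 1 keeps it positive when n = 0. *)
  pose c := \big[Num.min/1]_i e i; have c0 : 0 < c by exact: lt_bigmin.
  have ce i : c <= e i by exact: bigmin_le.
  exists c => //; have [M fM] := bounded_sums_le (fun=> c0) ce fe.
  exists M => d; have := fM _ (bms_uniq d); apply: le_trans.
  by rewrite /nrm; apply: ler_sum => m _; rewrite mw.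
apply/convergentP; exists (fun=> e) => //; exists M => t ut.
have [d td] : exists d, {subset t <= bms d}.
  exists (\max_(m <- t) mdeg m).+1 => m mt; rewrite mem_bms ltnS.
  by apply: leq_bigmax_seq.
apply: le_trans (fM d); rewrite /nrm.
under eq_bigr => m _ do rewrite mw.
apply: ler_sum_subseq; rewrite ?bms_uniq // => m.
by rewrite mulr_ge0 ?absv_ge0 // exprn_ge0 ?ltW.
Qed.

Lemma nrm_conv_ord o f : convergent v f -> ordge o f ->
  exists2 e0 : R, 0 < e0 & exists2 C : R, 0 <= C &
    forall e d, 0 <= e -> e <= e0 -> nrm d e f <= C * e ^+ o.
Proof.
move=> /convergent_nrm[e0 e00 [M fM]] fo; exists e0 => //.
have M0 : 0 <= M by exact: le_trans (nrm_ge0 0 f (ltW e00)) (fM 0%N).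
exists (M / e0 ^+ o); first by rewrite divr_ge0 // exprn_ge0 // ltW.
move=> e d e_ge0 ee0; apply: le_trans (nrm_ord _ e_ge0 ee0 e00 fo) _.
rewrite expr_div_n mulrC mulrA mulrAC; apply: ler_wpM2r; first exact: exprn_ge0.
by apply: ler_wpM2r => //; rewrite invr_ge0 exprn_ge0 // ltW.
Qed.

(* Every coefficient of the iterates is eventually constant, so that no completeness of K
   is needed; as nrm d only sees the degrees below d, the limit inherits the bounds of
   the iterates. *)
Lemma fps_fixpoint (I : Type) (Phi : (I -> fps n K) -> I -> fps n K) a e (r : I -> R) :
  let B z := (forall k, ordge a (z k)) /\ (forall k d, nrm d e (z k) <= r k) in
    (forall k, 0 <= r k) ->
    (forall z, B z -> B (Phi z)) ->
    (forall z z' t, B z -> B z' -> (forall k, ordge t (z k - z' k)) ->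
       forall k, ordge t.+1 (Phi z k - Phi z' k)) ->
  exists2 z, B z & forall k, Phi z k = z k.
Proof.
move=> B r0 PB Pc; pose zt t := iter t Phi (fun=> 0).
have Bz t : B (zt t).
  by elim: t => [|t IH]; [split=> [//|i d]; rewrite nrm0|exact: PB].
have zS t : forall i : I, ordge t (zt t.+1 i - zt t i).
  by elim: t => [|t IH] i; [exact: ordge_trivial|exact: (Pc _ _ _ (Bz t.+1) (Bz t) IH)].
have zk t k (i : I) : ordge t (zt (t + k)%N i - zt t i).
  elim: k => [|k IH]; first by rewrite addn0 subrr.
  rewrite addnS -[_ - _](subrKA (zt (t + k)%N i)); apply: ordgeD => //.
  by apply: ordgeW (zS _ i); rewrite leq_addr.
(* Iterates from step t on agree below degree t, so a coefficient of degree [mdeg m] is final at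
   step [(mdeg m).+1]. *)
pose z (i : I) : fps n K := fun m => zt (mdeg m).+1 i m.
have zE t (i : I) : ordge t (z i - zt t i).
  apply/ordge_eq => m mt; rewrite -(subnKC mt); apply/esym.
  exact: (proj1 (ordge_eq _ _ _) (zk (mdeg m).+1 _ i)).
have zB : B z.
  split=> i; last by move=> d; rewrite (eq_nrm _ (zE d i)); have [] := Bz d.
  by rewrite -[z i](subrK (zt a i)); apply: ordgeD => //; have [] := Bz a.
exists z => // i; apply/eqP; rewrite -subr_eq0; apply/eqP/ordge_eq0 => t.
rewrite -[_ - _](subrKA (Phi (zt t) i)); apply: ordgeD.
  by apply: ordgeW (leqnSn t) _; apply: Pc.
by rewrite -opprB; apply/ordgeN/(ordgeW (leqnSn t))/(zE t.+1).
Qed.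

End TruncatedNorm.

(** * The local ring of convergent power series *)

Local Open Scope classical_set_scope.
Local Open Scope quotient_scope.

Section ConvergentSubstitution.
Context {n : nat} {R : realType} {K : fieldType} {v : absValue R K}.
Implicit Types (f g h : cps n v) (i j : 'I_n).

Lemma cps_conv f : convergent v f.
Proof. exact/asboolP/(cps_valP f). Qed.

Lemma conv_cps (f : fps n K) : convergent v f -> exists g : cps n v, g = f :> fps n K.
Proof. by move=> /asboolP cf; exists (Cps cf). Qed.

Lemma cps_inj f g : f = g :> fps n K -> f = g.
Proof. exact: val_inj. Qed.

Lemma cpsD f g : (f + g : cps n v) = (f : fps n K) + (g : fps n K) :> fps n K. Proof. by []. Qed.
Lemma cpsN f : (- f : cps n v) = - (f : fps n K) :> fps n K. Proof. by []. Qed.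
Lemma cpsM f g : (f * g : cps n v) = (f : fps n K) * (g : fps n K) :> fps n K. Proof. by []. Qed.
Lemma cpsZ (a : K) f : (a *: f : cps n v) = a *: (f : fps n K) :> fps n K.
Proof. by []. Qed.
Lemma cps1 : (1 : cps n v) = 1 :> fps n K. Proof. by []. Qed.
Lemma cps0 : (0 : cps n v) = 0 :> fps n K. Proof. by []. Qed.
Lemma cps_sum (I : Type) (r : seq I) (P : pred I) (F : I -> cps n v) :
  (\sum_(k <- r | P k) F k : cps n v) = \sum_(k <- r | P k) (F k : fps n K) :> fps n K.
Proof. by elim/big_rec2: _ => // k y x _ <-. Qed.

Definition cpsE := (cpsD, cpsN, cpsM, cpsZ, cps1, cps0, cps_sum).

Lemma nrm_conv (f : fps n K) e M : 0 < e -> (forall d, nrm v d e f <= M) -> convergent v f.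
Proof. by move=> e0 fM; apply/convergent_nrm; exists e => //; exists M. Qed.

Lemma fdiv_conv j (f : fps n K) : convergent v f -> convergent v (fdiv j f).
Proof.
move=> /convergent_nrm[e e0 [M fM]]; apply: (@nrm_conv _ e (M / e)) => // d.
by rewrite ler_pdivlMr // (le_trans (nrm_fdiv _ _ _ _ (ltW e0))).
Qed.

Lemma cps_divP j f : fdiv j f \in convergentp v.
Proof. exact/asboolP/fdiv_conv/cps_conv. Qed.

Definition cps_div j f : cps n v := Cps (cps_divP j f).

Definition cps_cst f : K := (f : fps n K) 0%MM.

Lemma cps_decomp f : f = (cps_cst f)%:A + \sum_j cps_var j * cps_div j f.
Proof. by apply: cps_inj; rewrite !cpsE {1}[f : fps n K]fps_decomp. Qed.

Lemma nrm_conv_ord_fam (I : finType) (u : I -> fps n K) o :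
    (forall k, convergent v (u k)) -> (forall k, ordge o (u k)) ->
  exists2 e0 : R, 0 < e0 & exists2 C : R, 0 <= C &
    forall k e d, 0 <= e -> e <= e0 -> nrm v d e (u k) <= C * e ^+ o.
Proof.
move=> uc uo.
have /choice[eC eCP] : forall k, exists eC : R * R, [/\ 0 < eC.1, 0 <= eC.2 &
    forall e d, 0 <= e -> e <= eC.1 -> nrm v d e (u k) <= eC.2 * e ^+ o].
  by move=> k; have [e0 e00 [C C0 H]] := nrm_conv_ord (uc k) (uo k); exists (e0, C).
exists (\big[Num.min/1]_k (eC k).1).
  by apply: lt_bigmin => // k _; have [] := eCP k.
exists (\sum_k (eC k).2); first by apply: sumr_ge0 => k _; have [] := eCP k.
move=> k e d e0 ek; have [_ _ H] := eCP k.
apply: le_trans (H e d e0 (le_trans ek (bigmin_le _ _ _))) _.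
rewrite ler_wpM2r ?exprn_ge0 // (bigD1 k) //= lerDl.
by apply: sumr_ge0 => k' _; have [] := eCP k'.
Qed.

Lemma fsub_conv (u : 'I_n -> fps n K) (f : fps n K) :
  (forall i, convergent v (u i)) -> (forall i, ordge 1 (u i)) -> convergent v f ->
  convergent v (fsub u f).
Proof.
move=> uc u1 /convergent_nrm[r r0 [M fM]].
have [e0 e00 [C C0 uC]] := nrm_conv_ord_fam uc u1.
pose e := Num.min e0 (r / (C + 1)).
have C1 : 0 < C + 1 by lra.
have e_gt0 : 0 < e by rewrite lt_min e00 divr_gt0.
apply: (@nrm_conv _ e M) => // d; apply: le_trans (fM d).
apply: nrm_fsub => //; try exact: ltW.
move=> i; apply: le_trans (uC i e d (ltW e_gt0) _) _; first by rewrite ge_min lexx.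
have : e <= r / (C + 1) by rewrite ge_min lexx orbT.
by rewrite ler_pdivlMr // expr1; nra.
Qed.

Section Substitution.
Variables (u : 'I_n -> cps n v) (u1 : forall i, ordge 1 (u i)).

Lemma cps_subP f : fsub (fun i => u i : fps n K) f \in convergentp v.
Proof. by apply/asboolP/fsub_conv => // [i|]; exact: cps_conv. Qed.

Definition cps_sub f : cps n v := Cps (cps_subP f).

Fact cps_sub_zmod : zmod_morphism cps_sub.
Proof. by move=> f g; apply: cps_inj; rewrite /= fsubB. Qed.

Fact cps_sub_scale : scalable cps_sub.
Proof. by move=> a f; apply: cps_inj; rewrite /= fsubZ. Qed.

Fact cps_sub_monoid : monoid_morphism cps_sub.
Proof.
by split=> [|f g]; apply: cps_inj; rewrite /= ?fsub1 // fsubM.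
Qed.

HB.instance Definition _ :=
  GRing.isZmodMorphism.Build (cps n v) (cps n v) cps_sub cps_sub_zmod.
HB.instance Definition _ :=
  GRing.isScalable.Build K (cps n v) (cps n v) *:%R cps_sub cps_sub_scale.
HB.instance Definition _ :=
  GRing.isMonoidMorphism.Build (cps n v) (cps n v) cps_sub cps_sub_monoid.

Definition cps_subst : {lrmorphism cps n v -> cps n v} := cps_sub.

Lemma cps_substE f : cps_subst f = fsub (fun i => u i : fps n K) f :> fps n K.
Proof. by []. Qed.

Lemma cps_subst_var j : cps_subst (cps_var j) = u j.
Proof. by apply: cps_inj; rewrite cps_substE fsub_var. Qed.

Lemma ordge_cps_subst N f : ordge N f -> ordge N (cps_subst f).
Proof. exact: ordge_fsub. Qed.

End Substitution.

Lemma lrmorph_rec (phi : {lrmorphism cps n v -> cps n v}) f :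
  phi f = (cps_cst f)%:A + \sum_j phi (cps_var j) * phi (cps_div j f).
Proof.
rewrite {1}[f]cps_decomp rmorphD rmorph_sum.
by congr (_ + _); [exact: rmorph_alg|]; apply: eq_bigr => j _; rewrite rmorphM.
Qed.

(** Two morphisms with the same values on the variables satisfy the same recursion along [cps_div].
    In particular every local automorphism is a substitution. *)
Lemma lrmorph_ext (phi psi : {lrmorphism cps n v -> cps n v}) :
    (forall i, ordge 1 (phi (cps_var i))) ->
    (forall i, phi (cps_var i) = psi (cps_var i)) ->
  phi =1 psi.
Proof.
move=> phi1 E f; apply: cps_inj; apply/eqP; rewrite -subr_eq0; apply/eqP.
move: f; apply: (rec_eq0 (dv := cps_div) phi1) => f.
rewrite (lrmorph_rec phi f) (lrmorph_rec psi f) !cpsE.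
rewrite opprD addrACA subrr add0r -sumrB.
by apply: eq_bigr => j _; rewrite -E !cpsE mulrBr.
Qed.

Lemma cps_unit_ord0 f : cps_cst f != 0 -> f \is a GRing.unit.
Proof.
move=> f0; pose c := cps_cst f; pose f1 := (f : fps n K) - c%:A.
have f1o : ordge 1 f1.
  by apply/ordge1P; rewrite /f1 fpsD fpsN fpsZ fps1 eqxx mulr1 subrr.
have f1c : convergent v f1 := cps_conv (f - c%:A).
have [e0 e00 [C C0 fC]] := nrm_conv_ord f1c f1o.
pose ci := v c^-1; have ci0 : 0 <= ci by exact: absv_ge0.
pose e := Num.min e0 (1 / (2 * (C * ci + 1))).
have P0 : 0 < 2 * (C * ci + 1) by nra.
have e_gt0 : 0 < e by rewrite lt_min e00 divr_gt0.
have e_ge0 := ltW e_gt0.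
have ee0 : e <= e0 by rewrite ge_min lexx.
have eC : C * ci * e <= 1 / 2.
  have : e <= 1 / (2 * (C * ci + 1)) by rewrite ge_min lexx orbT.
  by rewrite ler_pdivlMr //; nra.
(* The inverse of f = c + f1 is the fixed point of z = (1 - f1 z) / c. At the radius e,
   multiplication by f1 / c has norm at most 1/2, so the ball of radius 2 * ci is preserved. *)
pose Phi (z : unit -> fps n K) (_ : unit) : fps n K := c^-1 *: (1 - f1 * z tt).
have [|z [_ zB]|z z' t _ _ zz' k|z [_ zB] zE] := @fps_fixpoint _ _ _ v _ Phi 0 e (fun=> 2 * ci).
- by move=> _; lra.
- split=> [//|k d]; rewrite /Phi nrmZ -/ci mulrC; apply: ler_wpM2r => //.
  apply: le_trans (ler_nrmB _ _ _ _ e_ge0) _.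
  have A2 : nrm v d e (1 : fps n K) <= 1 by exact: nrm1_le1.
  have := fC e d e_ge0 ee0; rewrite expr1 => A1.
  have A3 := zB tt d; have A4 := ler_nrmM v d f1 (z tt) e_ge0.
  have A5 : nrm v d e f1 * nrm v d e (z tt) <= C * e * (2 * ci).
    by apply: ler_pM => //; exact: nrm_ge0.
  nra.
- rewrite /Phi -scalerBr; apply: ordgeZ.
  rewrite (_ : _ - _ = f1 * (z' tt - z tt)); last by ring.
  by rewrite -add1n; apply: ordgeM => //; rewrite -opprB; apply: ordgeN.
have [w wE] := conv_cps (nrm_conv e_gt0 (zB tt)).
suff fw : w * f = 1 by apply/unitrPr; exists w; rewrite mulrC.
apply: cps_inj; rewrite cpsM cps1 wE.
have : c *: Phi z tt = c *: z tt by rewrite zE.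
rewrite /Phi scalerA divff // scale1r => H.
rewrite (_ : (f : fps n K) = f1 + c%:A); last by rewrite /f1 subrK.
by rewrite mulrDr -scalerAr mulr1 -H mulrC addrC subrK.
Qed.

End ConvergentSubstitution.

Section IdealGen.
Context {A : comNzRingType}.
Implicit Types (S : set A).

Lemma ideal_gen_mem S x : S x -> ideal_gen S x.
Proof.
move=> Sx; exists [:: (1, x)]; rewrite big_seq1 mul1r; split=> // p.
by rewrite inE => /eqP->.
Qed.

Lemma ideal_gen_ind S (P : A -> Prop) :
    P 0 -> (forall x y, P x -> P y -> P (x + y)) -> (forall a x, P x -> P (a * x)) ->
    (forall x, S x -> P x) ->
  forall x, ideal_gen S x -> P x.
Proof.
move=> P0 PD PM SP _ [s [sS ->]]; rewrite big_seq; elim/big_ind: _ => // p ps.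
exact/PM/SP/sS.
Qed.

Lemma ideal_gen_sum S (I : Type) (r : seq I) (P : pred I) (F : I -> A) :
  (forall k, P k -> ideal_gen S (F k)) -> ideal_gen S (\sum_(k <- r | P k) F k).
Proof.
move=> FS; elim/big_ind: _ => //; first exact: ideal_gen0.
by move=> x y; exact: ideal_genD.
Qed.

Lemma ideal_genU1P S f x :
  ideal_gen (f |` S) x <-> exists a y, ideal_gen S y /\ x = a * f + y.
Proof.
split=> [|[a [y [Sy ->]]]].
  move: x; apply: ideal_gen_ind.
  - by exists 0, 0; split; [exact: ideal_gen0|rewrite mul0r addr0].
  - move=> _ _ [a [x [Sx ->]]] [b [y [Sy ->]]]; exists (a + b), (x + y).
    by split; [exact: ideal_genD|ring].
  - move=> a _ [b [x [Sx ->]]]; exists (a * b), (a * x).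
    by split; [exact: ideal_genMl|ring].
  - move=> x [->|Sx]; first by exists 1, 0; split; [exact: ideal_gen0|ring].
    by exists 0, x; split; [exact: ideal_gen_mem|ring].
apply: ideal_genD; first by apply/ideal_genMl/ideal_gen_mem; left.
move: y Sy; apply: ideal_gen_ind; [exact: ideal_gen0|exact: ideal_genD|exact: ideal_genMl|].
by move=> y Sy; apply/ideal_gen_mem; right.
Qed.

Lemma ideal_gen_idem S x : ideal_gen (ideal_gen S) x <-> ideal_gen S x.
Proof.
split; last exact: ideal_gen_mem.
by apply: ideal_gen_ind; [exact: ideal_gen0|exact: ideal_genD|exact: ideal_genMl|].
Qed.

Lemma ideal_gen_rangeP (I : finType) (F : I -> A) x :
  ideal_gen (range F) x <-> exists c : I -> A, x = \sum_i c i * F i.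
Proof.
split=> [|[c ->]]; last first.
  by apply: ideal_gen_sum => i _; apply/ideal_genMl/ideal_gen_mem; exists i.
move: x; apply: ideal_gen_ind.
- by exists (fun=> 0); rewrite big1 // => i _; rewrite mul0r.
- move=> _ _ [c ->] [c' ->]; exists (fun i => c i + c' i); rewrite -big_split.
  by apply: eq_bigr => i _; rewrite mulrDl.
- move=> a _ [c ->]; exists (fun i => a * c i); rewrite mulr_sumr.
  by apply: eq_bigr => i _; rewrite mulrA.
- move=> _ [i _ <-]; exists (fun k => (k == i)%:R); rewrite (bigD1 i) //= eqxx mul1r.
  by rewrite big1 ?addr0 // => k /negbTE->; rewrite mul0r.
Qed.

End IdealGen.

Section LocalRing.
Context {n : nat} {R : realType} {K : fieldType} {v : absValue R K}.
Implicit Types (f g h : cps n v) (i j : 'I_n).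

Lemma cps_cstM f g : cps_cst (f * g) = cps_cst f * cps_cst g.
Proof.
pose f1 : fps n K := (f : fps n K) - (cps_cst f)%:A.
have f1o : ordge 1 f1.
  by apply/ordge1P; rewrite /f1 fpsD fpsN fpsZ fps1 eqxx mulr1 subrr.
have fgE : (f : fps n K) * (g : fps n K) = f1 * (g : fps n K) + cps_cst f *: (g : fps n K).
  by rewrite /f1 mulrBl -scalerAl mul1r subrK.
rewrite {1}/cps_cst cpsM fgE fpsD fpsZ.
have /ordge1P -> : ordge 1 (f1 * (g : fps n K)) by exact: ordgeMr.
by rewrite add0r.
Qed.

Lemma cps_unitE f : (f \is a GRing.unit) = (cps_cst f != 0).
Proof.
apply/idP/idP => [/divrr|]; last exact: cps_unit_ord0.
move=> /(congr1 cps_cst); rewrite cps_cstM => H; apply/eqP => f0.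
move/eqP: H; rewrite f0 mul0r /cps_cst cps1 fps1 eqxx eq_sym oner_eq0 //.
Qed.

(** This description of m in terms of the ring structure is what lets ring morphisms be seen to
    respect the order. *)
Lemma ordge1_unit f : ordge 1 f <-> f \isn't a GRing.unit.
Proof. by rewrite cps_unitE negbK ordge1P; split=> /eqP. Qed.

Lemma maxidealP h : maxideal h <-> ordge 1 h.
Proof.
rewrite /maxideal ideal_gen_rangeP; split=> [[c ->]|h1].
  by rewrite cps_sum; apply: ordge_sum => i _; apply/ordgeMl/ordge_var.
exists (fun i => cps_div i h); rewrite {1}[h]cps_decomp.
rewrite /cps_cst (proj1 (ordge1P _) h1) scale0r add0r.
by apply: eq_bigr => i _; rewrite mulrC.
Qed.

Lemma ideal_exp_maxP k h : ideal_exp maxideal k h <-> ordge k h.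
Proof.
elim: k h => [|k IH] h; first by split.
rewrite /ideal_exp iterS -/(ideal_exp maxideal k); split=> [|hk].
  move: h; apply: ideal_gen_ind => //.
  - by move=> x y; exact: ordgeD.
  - by move=> a x; exact: ordgeMl.
  - move=> _ [x /maxidealP x1 [y /IH yk <-]].
    by rewrite -add1n; exact: ordgeM.
have h1 : ordge 1 h by exact: ordgeW hk.
rewrite [h]cps_decomp /cps_cst (proj1 (ordge1P _) h1) scale0r add0r.
apply: ideal_gen_sum => i _; apply: ideal_gen_mem; exists (cps_var i).
  by apply: ideal_gen_mem; exists i.
by exists (cps_div i h) => //; apply/IH/ordge_fdiv.
Qed.

Lemma ideal_exp_mulP (I : finType) k (F : I -> cps n v) h :
  ideal_mul (ideal_exp maxideal k) (ideal_gen (range F)) h <->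
  exists2 c : I -> cps n v, (forall l, ordge k (c l)) & h = \sum_l c l * F l.
Proof.
split=> [|[c ck ->]]; last first.
  apply: ideal_gen_sum => i _; apply: ideal_gen_mem; exists (c i).
    exact/ideal_exp_maxP.
  by exists (F i) => //; apply: ideal_gen_mem; exists i.
move: h; apply: ideal_gen_ind.
- by exists (fun=> 0) => //; rewrite big1 // => i _; rewrite mul0r.
- move=> _ _ [c ck ->] [c' ck' ->]; exists (fun l => c l + c' l).
    by move=> i; rewrite cpsD; exact: ordgeD.
  by rewrite -big_split; apply: eq_bigr => i _; rewrite mulrDl.
- move=> a _ [c ck ->]; exists (fun l => a * c l) => [i|]; first by rewrite cpsM; exact: ordgeMl.
  by rewrite mulr_sumr; apply: eq_bigr => i _; rewrite mulrA.
- move=> _ [x /ideal_exp_maxP xk [y /ideal_gen_rangeP[c ->] <-]].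
  exists (fun l => x * c l) => [i|]; first by rewrite cpsM; exact: ordgeMr.
  by rewrite mulr_sumr; apply: eq_bigr => i _; rewrite mulrA.
Qed.

(** The inverse function theorem for x + q(x): z is the fixed point of z = x - q(z), which contracts
    because q has order 2. *)
Lemma fsub_near_id (q : 'I_n -> cps n v) : (forall i, ordge 2 (q i)) ->
  exists z : 'I_n -> cps n v, [/\ forall i, ordge 1 (z i),
    forall i, ordge 2 ((z i : fps n K) - fps_var i) &
    forall i, (z i : fps n K) + fsub (fun i => z i : fps n K) (q i) = fps_var i].
Proof.
move=> q2; have [e0 e00 [C C0 qC]] := nrm_conv_ord_fam (fun i => cps_conv (q i)) q2.
(* The ball has radius 2 * e: for z in it, q(z) has norm at most C (2 e)^2 <= e, because 4 C e <=
   1. *)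
pose e := Num.min (e0 / 2) (1 / (4 * (C + 1))).
have P0 : 0 < 4 * (C + 1) by lra.
have e_gt0 : 0 < e by rewrite lt_min !divr_gt0.
have e_ge0 := ltW e_gt0.
have ee0 : 2 * e <= e0.
  by have : e <= e0 / 2 by [rewrite ge_min lexx]; lra.
have eC : 4 * C * e <= 1.
  have : e <= 1 / (4 * (C + 1)) by rewrite ge_min lexx orbT.
  by rewrite ler_pdivlMr //; nra.
pose Phi (z : 'I_n -> fps n K) i : fps n K := fps_var i - fsub z (q i).
have [||z z' t [z1 _] [z'1 _] zz' k|z [z1 zB] zE] :=
    @fps_fixpoint _ _ _ v _ Phi 1 e (fun=> 2 * e).
- by move=> _; lra.
- move=> z [z1 zB]; split=> k; rewrite /Phi.
    apply: ordgeB; first exact: ordge_var.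
    by apply: ordge_fsub => //; exact: ordgeW (q2 k).
  move=> d; apply: le_trans (ler_nrmB _ _ _ _ e_ge0) _.
  have := nrm_var v d k e_ge0.
  have : nrm v d e (fsub z (q k)) <= nrm v d (2 * e) (q k).
    by apply: nrm_fsub => //; lra.
  have := qC k (2 * e) d (mulr_ge0 (ler0n _ _) e_ge0) ee0; rewrite expr2.
  by nra.
- rewrite /Phi (_ : _ - _ = fsub z' (q k) - fsub z (q k)); last by ring.
  rewrite -add1n; apply: fsub_lip => // i.
  by rewrite -opprB; exact: ordgeN.
have /choice[w wE] k : exists w : cps n v, w = z k :> fps n K.
  exact: conv_cps (nrm_conv e_gt0 (zB k)).
have wz : (fun i => w i : fps n K) = z by apply/funext => i; rewrite wE.
exists w; rewrite wz; split=> i; rewrite ?wE //.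
  rewrite -zE /Phi addrAC subrr add0r; apply/ordgeN.
  by apply: ordge_fsub => //; exact: q2.
by rewrite -{1}zE /Phi subrK.
Qed.

(** A left inverse of a substitution close to the identity is again close to the identity, so it has
    a left inverse of its own and is therefore two-sided. *)
Lemma subst_bij (u : 'I_n -> cps n v) (u1 : forall i, ordge 1 (u i)) :
  (forall i, ordge 2 ((u i : fps n K) - fps_var i)) -> bijective (cps_subst u1).
Proof.
have X1 i : ordge 1 (fps_var i : fps n K) by exact: ordge_var.
have left_inv (w : 'I_n -> cps n v) (w1 : forall i, ordge 1 (w i)) :
    (forall i, ordge 2 ((w i : fps n K) - fps_var i)) ->
  exists z : 'I_n -> cps n v, exists z1 : forall i, ordge 1 (z i),
    (forall i, ordge 2 ((z i : fps n K) - fps_var i)) /\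
    cancel (cps_subst w1) (cps_subst z1).
  move=> w2; have [|z [z1 z2 zE]] := @fsub_near_id (fun i => w i - cps_var i).
    by move=> i; rewrite !cpsE; exact: w2.
  exists z, z1; split=> // f; apply: cps_inj; rewrite !cps_substE fsub_comp //.
  rewrite -[RHS]fsub_id; congr (fsub _ _); apply/funext => i.
  by rewrite -[RHS]zE !cpsE fsubB fsub_var // addrC subrK.
move=> /left_inv-/(_ u1)[z [z1 [z2 uz]]].
have [y [y1 [_ zy]]] := left_inv z z1 z2.
exists (cps_subst z1) => //.
have zi : injective (cps_subst z1) by exact: can_inj zy.
by move=> f; apply: zi; rewrite uz.
Qed.

Lemma local_aut_subst (u : 'I_n -> cps n v) (u1 : forall i, ordge 1 (u i)) :
  bijective (cps_subst u1) -> local_aut (cps_subst u1).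
Proof. by split=> // h /maxidealP h1; apply/maxidealP/ordge_cps_subst. Qed.

(** The inverse is local because m is the set of nonunits and [phi] preserves units. *)
Lemma local_aut_inv (phi : {lrmorphism cps n v -> cps n v}) : local_aut phi ->
  exists psi : {lrmorphism cps n v -> cps n v},
    [/\ local_aut psi, cancel phi psi & cancel psi phi].
Proof.
move=> [[psi phiK psiK] phim].
have psiz : zmod_morphism psi := can2_zmod_morphism phiK psiK.
have psim : monoid_morphism psi := can2_monoid_morphism phiK psiK.
have psis : scalable psi := can2_scalable phiK psiK.
pose psiM := GRing.isMonoidMorphism.Build _ _ psi psim.
pose psiZ := GRing.isZmodMorphism.Build _ _ psi psiz.
pose psiS := GRing.isScalable.Build _ _ _ *:%R psi psis.
pose psi' : {lrmorphism cps n v -> cps n v} := HB.pack psi psiM psiZ psiS.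
exists psi'; split=> //; split; first by exists phi.
move=> h /maxidealP/ordge1_unit hm; apply/maxidealP/ordge1_unit.
apply: contra hm => /(rmorph_unit phi) /=.
by rewrite (psiK h).
Qed.

Lemma local_aut_comp (phi psi : {lrmorphism cps n v -> cps n v}) :
  local_aut phi -> local_aut psi -> local_aut (phi \o psi).
Proof.
move=> [phib phim] [psib psim]; split; first exact: bij_comp.
by move=> h /psim/phim.
Qed.

Lemma local_aut_ord (phi : {lrmorphism cps n v -> cps n v}) k h :
  local_aut phi -> ordge k h -> ordge k (phi h).
Proof.
move=> [_ phim]; have phi1 i : ordge 1 (phi (cps_var i)).
  by apply/maxidealP/phim/maxidealP/ordge_var.
rewrite (lrmorph_ext phi1 (psi := cps_subst phi1)) ?(cps_subst_var phi1) //.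
  exact: ordge_cps_subst.
by move=> i; rewrite cps_subst_var.
Qed.

End LocalRing.

(** * Finite determinacy *)

Section Determinacy.
Context {n : nat} {R : realType} {K : fieldType} {v : absValue R K}.
Implicit Types (i j : 'I_n).

(* Linear solutions of p * h = \sum_k c_k * G k for all formal h of order at least l,
   with norm estimates.  Only the monomials of degree l have to be expressed by the G k
   over K{x}: the division by the variables spreads these expressions linearly. *)
Lemma division_operators (I : finType) (G : I -> fps n K) a l (p : fps n K) :
    convergent v p ->
    (forall m : 'X_{1..n}, mdeg m = l -> exists c : I -> cps n v,
       (forall k, ordge a (c k)) /\ p * fmon m = \sum_k (c k : fps n K) * G k) ->
  exists (T : I -> fps n K -> fps n K) (e0 C : R), 0 < e0 /\ 0 <= C /\
  [/\ forall k h h', T k (h - h') = T k h - T k h',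
      forall h, ordge l h -> p * h = \sum_k T k h * G k,
      forall k h t, ordge (l + t) h -> ordge (a + t) (T k h) &
      forall k h e B, 0 < e -> e <= e0 -> (forall d, nrm v d e h <= B) ->
        forall d, nrm v d e (T k h) * e ^+ l <= C * e ^+ a * B].
Proof.
elim: l p => [|l IH] p pc Hp.
  have [c [ca]] := Hp 0%MM mdeg0; rewrite fmon0 mulr1 => pE.
  have [e0 e00 [C C0 cC]] := nrm_conv_ord_fam (fun k => cps_conv (c k)) ca.
  exists (fun k h => (c k : fps n K) * h), e0, C; do ! split=> //.
  - by move=> k h h'; rewrite mulrBr.
  - by move=> h _; rewrite pE mulr_suml; apply: eq_bigr => k _; rewrite mulrAC.
  - by move=> k h t ht; apply: ordgeM.
  - move=> k h e B e_gt0 ee0 hB d; rewrite expr0 mulr1.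
    apply: le_trans (ler_nrmM _ _ _ _ (ltW e_gt0)) _.
    by apply: ler_pM => //; [exact/nrm_ge0/ltW|exact/nrm_ge0/ltW|apply: cC => //; exact: ltW].
(* The multiplier p exists for this induction: a monomial of degree l + 1 is a variable times one of
   degree l, and the variable is moved into p. *)
have /choice[T TP] j : exists T : (I -> fps n K -> fps n K) * R * R,
    0 < T.1.2 /\ 0 <= T.2 /\
  [/\ forall k h h', T.1.1 k (h - h') = T.1.1 k h - T.1.1 k h',
      forall h, ordge l h -> fps_var j * p * h = \sum_k T.1.1 k h * G k,
      forall k h t, ordge (l + t) h -> ordge (a + t) (T.1.1 k h) &
      forall k h e B, 0 < e -> e <= T.1.2 -> (forall d, nrm v d e h <= B) ->
        forall d, nrm v d e (T.1.1 k h) * e ^+ l <= T.2 * e ^+ a * B].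
  have [||T [e0 [C TP]]] := IH (fps_var j * p).
  - have [q qE] := conv_cps pc; rewrite -qE.
    exact: (cps_conv (cps_var j * q)).
  - move=> m ml; have [|c [ca cE]] := Hp (U_(j) + m)%MM.
      by rewrite mdegD mdeg1 ml.
    by exists c; split=> //; rewrite -cE fmonS; ring.
  - by exists (T, e0, C).
pose e0 := \big[Num.min/1]_j (T j).1.2; pose C := \sum_j (T j).2.
exists (fun k h => \sum_j (T j).1.1 k (fdiv j h)), e0, C; split.
  by apply: lt_bigmin => // j _; have [] := TP j.
split; first by apply: sumr_ge0 => j _; have [_ []] := TP j.
split.
- move=> k h h'; rewrite -sumrB; apply: eq_bigr => j _.
  by have [_ [_ [TB _ _ _]]] := TP j; rewrite fdivB TB.
- move=> h hl; have h1 : ordge 1 h by exact: ordgeW hl.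
  rewrite {1}(ordge_decomp h1) mulr_sumr.
  under [RHS]eq_bigr => k _ do rewrite mulr_suml.
  rewrite exchange_big /=; apply: eq_bigr => j _.
  have [_ [_ [_ TE _ _]]] := TP j; rewrite -TE; first by ring.
  exact: ordge_fdiv.
- move=> k h t; rewrite addSn => ht; apply: ordge_sum => j _.
  have [_ [_ [_ _ To _]]] := TP j.
  exact/To/ordge_fdiv.
- move=> k h e B e_gt0 ee0 hB d; have e_ge0 := ltW e_gt0.
  apply: le_trans (ler_wpM2r (exprn_ge0 _ e_ge0) (ler_nrm_sum _ _ _ _ _ e_ge0)) _.
  rewrite /C !mulr_suml; apply: ler_sum => j _.
  have [_ [_ [_ _ _ Tn]]] := TP j.
  (* Each division by a variable costs a factor 1 / e; the factor e ^+ l in the estimate pays for l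
     of them. *)
  have hB' d' : nrm v d' e (fdiv j h) <= B / e.
    by rewrite ler_pdivlMr // (le_trans (nrm_fdiv _ _ _ _ e_ge0)).
  have ej : e <= (T j).1.2 by apply: le_trans ee0 _; exact: bigmin_le.
  have := Tn k _ e _ e_gt0 ej hB' d.
  by rewrite mulrA ler_pdivlMr // exprSr mulrA.
Qed.

Lemma cps_mon (m : 'X_{1..n}) : exists q : cps n v, q = fmon m :> fps n K.
Proof.
move: m; apply: mnm_ind => [|j m [q qE]]; first by exists 1; rewrite fmon0.
by exists (cps_var j * q); rewrite fmonS -qE.
Qed.

(* chi = 1 is the contact case, chi = 0 the right case; a solution is a fixed point of
   (w, y) |-> T (h - taylor y f - chi w (f (x + y) - f)), with T the division operators. *)
Lemma determinacy (chi : K) (f h : cps n v) (o a D : nat) :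
    (1 < a)%N -> D.+1 = (o + a + a)%N -> ordge o.+2 f -> ordge D h ->
    (forall q : cps n v, ordge D q -> exists (w : cps n v) (y : 'I_n -> cps n v),
       [/\ ordge a w, forall i, ordge a (y i) &
           q = chi *: (w * f) + \sum_i y i * cps_deriv i f]) ->
  exists (w : cps n v) (y : 'I_n -> cps n v),
    [/\ ordge 1 w, forall i, ordge 2 (y i) &
        (1 + chi *: (w : fps n K)) * fsub (fun i => fps_var i + (y i : fps n K)) f =
        (f : fps n K) + (h : fps n K)].
Proof.
move=> a1 DE fo hD HD; pose I := option 'I_n.
pose X : 'I_n -> fps n K := fps_var.
have X1 i : ordge 1 (X i) by exact: ordge_var.
pose G (k : I) : fps n K :=
  if k is Some i then fps_deriv i f else chi *: (f : fps n K).
have bigI (F : I -> fps n K) : \sum_k F k = F None + \sum_i F (Some i).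
  rewrite (bigD1 None) //=; congr (_ + _).
  rewrite (reindex_omap Some id) /=; last by case.
  by apply: eq_bigl => i; rewrite eqxx.
have [||T [eT [C [eT0 [C0 [TB TE To Tn]]]]]] := @division_operators I G a D 1.
- exact: (cps_conv (1 : cps n v)).
- move=> m mD; have [q qE] := cps_mon m; have [|w [y [wa ya qwy]]] := HD q.
    rewrite qE -mD; apply: ordge_mmap1; exact: ordge_var.
  exists (fun k => if k is Some i then y i else w); split; first by case.
  rewrite bigI /= mul1r -qE qwy !cpsE scalerAr.
  by congr (_ + _).
have TE' q : ordge D q -> q = T None q * (chi *: (f : fps n K)) +
    \sum_i T (Some i) q * fps_deriv i f.
  by move=> /TE; rewrite bigI mul1r.
have [eh eh0 [H H0 hH]] := nrm_conv_ord (cps_conv h) hD.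
have [ef ef0 [F F0 fF]] := nrm_conv_ord (cps_conv f) fo.
(* The iteration runs in the ball of radius r e^a. There [E] has norm at most (H + 1) e^D, namely H
   e^D from h and e^D from all nonlinear terms, and [T] turns this into C (H + 1) e^a. *)
pose r := C * (H + 1); have r0 : 0 <= r by apply: mulr_ge0 => //; lra.
pose c := v chi; have c0 : 0 <= c by exact: absv_ge0.
pose M := (1 + c) * F * 3 ^+ o.+2.
have M0 : 0 <= M by apply: mulr_ge0 (exprn_ge0 _ _) => //; apply: mulr_ge0 => //; lra.
have Mr0 : 0 <= M * r ^+ 2 by rewrite mulr_ge0 // sqr_ge0.
(* r e <= 1 will give s <= 1, as the Taylor estimates demand; M r^2 e <= 1 makes the nonlinear terms
   at most e^D; 3 e <= ef because those estimates evaluate f at radius 3 * e. *)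
have [e [e_gt0 e1 eeT [eeh eef er eM]]] : exists e : R, [/\ 0 < e, e <= 1, e <= eT &
    [/\ e <= eh, 3 * e <= ef, r * e <= 1 & M * r ^+ 2 * e <= 1]].
  pose e := Num.min 1 (Num.min eT (Num.min eh (Num.min (ef / 3)
    (Num.min (1 / (r + 1)) (1 / (M * r ^+ 2 + 1)))))).
  have r1 : 0 < r + 1 by lra.
  have M1 : 0 < M * r ^+ 2 + 1 by lra.
  have e_gt0 : 0 < e by rewrite !lt_min ltr01 eT0 eh0 !divr_gt0.
  have : e <= e by [].
  rewrite {2}/e !le_min => /and5P[? ? ?]; rewrite !ler_pdivlMr // => ? /andP[? ?].
  by exists e; do ! split => //; lra.
have e_ge0 := ltW e_gt0.
have ep k : 0 <= e ^+ k by rewrite exprn_ge0.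
(* The size of y relative to that of the variables: r e^a = s e. *)
pose s := r * e ^+ a.-1.
have s0 : 0 <= s by rewrite mulr_ge0.
have s1 : s <= 1.
  apply: le_trans er; rewrite ler_wpM2l // -[leRHS]expr1 ler_wiXn2l //.
  by move: a1 DE; clear; lia.
have seE : s * e = r * e ^+ a by rewrite -mulrA -exprSr prednK // ltnW.
have sse : s ^+ 2 * e ^+ o.+2 = r ^+ 2 * (e ^+ D * e).
  rewrite /s exprMn -exprM -mulrA -exprD -exprSr DE; congr (_ * _ ^+ _).
  by move: a1 DE; clear; lia.
pose S (y : 'I_n -> fps n K) := fsub (fun i => X i + y i) f.
pose E (z : I -> fps n K) : fps n K := (h : fps n K) - taylor X (z \o Some) f -
  chi *: z None * (S (z \o Some) - (f : fps n K)).
pose Phi z k := T k (E z).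
have yo (y : 'I_n -> fps n K) : (forall i, ordge a (y i)) ->
    forall i, ordge 1 (y i) by move=> ya i; apply: ordgeW (ya i); move: a1; clear; lia.
have So y y' b : (forall i, ordge a (y i)) -> (forall i, ordge a (y' i)) ->
    (forall i, ordge b (y i - y' i)) -> ordge (o.+1 + b) (S y - S y').
  move=> ya y'a yb; apply: fsub_lip => // i.
  - by apply: ordgeD => //; exact: (yo _ ya i).
  - by apply: ordgeD => //; exact: (yo _ y'a i).
  - by rewrite opprD addrACA subrr add0r.
have S0 : S (fun=> 0) = f.
  rewrite /S -[RHS]fsub_id; congr (fsub _ _).
  by apply/funext => i; rewrite addr0.
have Sf y : (forall i, ordge a (y i)) -> ordge (o.+1 + a) (S y - (f : fps n K)).
  by move=> ya; rewrite -S0; apply: So => // i; rewrite subr0.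
have Eo z : (forall k, ordge a (z k)) -> ordge D (E z).
  move=> za; apply: ordgeB; first apply: ordgeB => //.
    apply: (@ordgeW _ _ (o + a + a)); first by move: a1 DE; clear; lia.
    by apply: ordge_taylor => //; [move: a1; clear; lia|move=> i; exact: za].
  apply: (@ordgeW _ _ (a + (o.+1 + a))); first by move: a1 DE; clear; lia.
  by apply: ordgeM; [exact/ordgeZ/za|apply: Sf => i; exact: za].
have [||z z' t [za _] [z'a _] zz' k|z [za zB] zE] :=
    @fps_fixpoint _ _ _ v _ Phi a e (fun=> r * e ^+ a).
- by move=> _; rewrite mulr_ge0.
- move=> z [za zB]; split=> k; first by rewrite -[a]addn0; apply: To; rewrite addn0; exact: Eo.
  move=> d; have zy d' i : nrm v d' e ((z \o Some) i) <= s * e by rewrite seE; exact: zB.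
  have y1 i : ordge 1 ((z \o Some) i) by apply: yo => j; exact: za.
  have EB d' : nrm v d' e (E z) <= e ^+ D * (H + 1).
    have A1 := hH e d' e_ge0 eeh.
    have A2 := fF (3 * e) d' (mulr_ge0 (ler0n _ _) e_ge0) eef.
    have A3 : nrm v d' e (taylor X (z \o Some) f) <= s ^+ 2 * nrm v d' (3 * e) f.
      exact: nrm_taylor.
    have A4 : nrm v d' e (S (z \o Some) - (f : fps n K)) <= s * nrm v d' (3 * e) f.
      exact: nrm_fsubB.
    have A5 : nrm v d' e (chi *: z None) <= c * s.
      rewrite nrmZ ler_wpM2l // (le_trans (zB None d')) // -seE.
      by rewrite ler_piMr.
    have A6 := ler_nrmM v d' (chi *: z None) (S (z \o Some) - (f : fps n K)) e_ge0.
    have A7 : nrm v d' e (chi *: z None) * nrm v d' e (S (z \o Some) - (f : fps n K)) <=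
        c * s * (s * nrm v d' (3 * e) f) by apply: ler_pM => //; exact: nrm_ge0.
    have A8 : s ^+ 2 * nrm v d' (3 * e) f <= s ^+ 2 * (F * (3 * e) ^+ o.+2).
      by rewrite ler_wpM2l ?sqr_ge0.
    have A9 : s ^+ 2 * (F * (3 * e) ^+ o.+2) = F * 3 ^+ o.+2 * (r ^+ 2 * (e ^+ D * e)).
      by rewrite -sse [(3 * e) ^+ _]exprMn; ring.
    have A10 : (1 + c) * (s ^+ 2 * nrm v d' (3 * e) f) <= M * r ^+ 2 * e * e ^+ D.
      apply: le_trans (ler_wpM2l _ A8) _; first by lra.
      by rewrite A9 le_eqVlt; apply/orP; left; apply/eqP; rewrite /M; ring.
    have A11 : M * r ^+ 2 * e * e ^+ D <= 1 * e ^+ D by rewrite ler_wpM2r.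
    have A12 := ler_nrmB v d' ((h : fps n K) - taylor X (z \o Some) f)
      (chi *: z None * (S (z \o Some) - (f : fps n K))) e_ge0.
    have A13 := ler_nrmB v d' (h : fps n K) (taylor X (z \o Some) f) e_ge0.
    rewrite -/(E z) in A12.
    have A14 : c * s * (s * nrm v d' (3 * e) f) = c * (s ^+ 2 * nrm v d' (3 * e) f) by ring.
    rewrite A14 in A7; rewrite mulrDl mul1r in A10; rewrite mul1r in A11.
    rewrite mulrDr mulr1 [e ^+ D * H]mulrC.
    move: A1 A3 A6 A7 A10 A11 A12 A13; clear; lra.
  have := Tn k _ e _ e_gt0 eeT EB d.
  rewrite (_ : C * e ^+ a * (e ^+ D * (H + 1)) = r * e ^+ a * e ^+ D); last by rewrite /r; ring.
  by rewrite ler_pM2r // exprn_gt0.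
(* Both series have order a, hence so does their difference; this matters in the first iterations,
   when t < a. *)
- have zzb : forall k, ordge (maxn a t) (z k - z' k).
    by move=> l; rewrite /maxn; case: ifP => _; [exact: zz'|exact: ordgeB].
  rewrite /Phi -TB; apply: (@ordgeW _ _ (a + (maxn a t - a).+1)).
    by move: a1 DE; clear; lia.
  (* Here D.+1 = o + a + a yields the contraction: [E] changes by order o + a + max(a, t) = D +
     (max(a, t) - a) + 1, and [T] lowers orders by D - a only, which leaves max(a, t) + 1. *)
  apply: To; apply: (@ordgeW _ _ (o + a + maxn a t)); first by move: a1 DE; clear; lia.
  pose y := z \o Some; pose y' := z' \o Some.
  rewrite (_ : E z - E z' = - (taylor X y f - taylor X y' f) -
    (chi *: (z None - z' None) * (S y - (f : fps n K)) +
     chi *: z' None * (S y - S y'))); last by rewrite /E scalerBr -/y -/y'; ring.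
  apply: ordgeB.
    apply: ordgeN; apply: ordge_taylorB => //; try by move=> i; rewrite /y /y' /=.
      by move: a1 DE; clear; lia.
    by move: a1 DE; clear; lia.
  apply: ordgeD.
    apply: (@ordgeW _ _ (maxn a t + (o.+1 + a))); first by move: a1 DE; clear; lia.
    apply: ordgeM; first exact/ordgeZ/zzb.
    by apply: Sf => i; exact: za.
  apply: (@ordgeW _ _ (a + (o.+1 + maxn a t))); first by move: a1 DE; clear; lia.
  apply: ordgeM; first exact/ordgeZ/z'a.
  by apply: So => i; [exact: za|exact: z'a|exact: zzb].
have zc k : exists q : cps n v, q = z k :> fps n K.
  exact: conv_cps (nrm_conv e_gt0 (zB k)).
have /choice[y yE] i := zc (Some i); have [w wE] := zc None.
exists w, y; split=> [|i|]; first by rewrite wE; apply: ordgeW (za None); move: a1; clear; lia.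
  by rewrite yE; exact: ordgeW (za (Some i)).
have -> : (fun i => fps_var i + (y i : fps n K)) = (fun i => X i + (z \o Some) i).
  by apply/funext => i; rewrite yE.
(* At the fixed point, [E z] equals chi w f plus the linear term L. Since L also occurs in [E z],
   inside the Taylor remainder, it cancels and the desired equation is left. *)
rewrite wE -/(S _); have := TE' _ (Eo z za).
rewrite (zE None : T None (E z) = _).
under eq_bigr => i _ do rewrite (zE (Some i) : T (Some i) (E z) = _).
rewrite /E /taylor -/(S _) fsub_id.
have -> : flin X (z \o Some) f = \sum_i z (Some i) * fps_deriv i f.
  by apply: eq_bigr => i _; rewrite fsub_id mulrC.
set L := \sum_i _; set Sz := S _; move=> EE.
apply/eqP; rewrite -subr_eq0; apply/eqP.
transitivity (z None * (chi *: (f : fps n K)) + L -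
  ((h : fps n K) - (Sz - (f : fps n K) - L) - chi *: z None * (Sz - (f : fps n K)))).
  rewrite -!scalerAr -!scalerAl mulrDl mul1r -scalerAl mulrBr scalerBr. ring.
by rewrite EE subrr.
Qed.

End Determinacy.

(** * Ideals of finite codimension *)

Section Dimension.
Context {n : nat} {R : realType} {K : fieldType} {v : absValue R K}.
Implicit Types (f g h : cps n v) (i j : 'I_n) (S : set (cps n v)).

Definition is_basis (V : lmodType K) d (b : 'I_d -> V) :=
  forall x, exists! c : {ffun 'I_d -> K}, x = \sum_(i < d) c i *: b i.

Lemma kdim_fin (V : lmodType K) : (kdim R V < +oo)%E ->
  exists d (b : 'I_d -> V), is_basis b /\ kdim R V = d%:R%:E.
Proof.
move=> Vfin; pose P d := `[<exists b : 'I_d -> V, is_basis b>].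
have exP : exists d, P d.
  apply: contrapT => nP; move: Vfin; rewrite /kdim (_ : image _ _ = set0).
    by rewrite ereal_inf0 ltxx.
  rewrite -subset0 => y [d [b bP] _]; apply: nP; exists d.
  by apply/asboolP; exists b.
have [d /asboolP[b bP] dmin] := ex_minnP exP.
exists d, b; split=> //; apply/eqP; rewrite eq_le; apply/andP; split.
  by apply: ereal_inf_lbound; exists d => //; exists b.
apply: le_ereal_inf_tmp => _ [k [c cP] <-]; rewrite lee_fin ler_nat.
by apply: dmin; apply/asboolP; exists c.
Qed.

Lemma basis_dependent (V : lmodType K) d (b : 'I_d -> V) (t : 'I_d.+1 -> V) :
  is_basis b -> exists2 u : 'rV[K]_d.+1, u != 0 & \sum_i u 0 i *: t i = 0.
Proof.
move=> bP.
have /choice[c cE] k : exists c : {ffun 'I_d -> K}, t k = \sum_(i < d) c i *: b i.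
  by have [c [cE _]] := bP (t k); exists c.
pose C := \matrix_(i < d.+1, j < d) c i j.
have : kermx C != 0.
  rewrite -mxrank_eq0 mxrank_ker subn_eq0 -ltnNge.
  exact: leq_ltn_trans (rank_leq_col C) _.
move=> /rowV0Pn[u /sub_kermxP uC u0]; exists u => //.
under eq_bigr => k _ do rewrite cE scaler_sumr.
rewrite exchange_big big1 //= => k _.
under eq_bigr => l _ do rewrite scalerA.
rewrite -scaler_suml; have -> : \sum_l u 0 l * c l k = (u *m C) 0 k.
  by rewrite mxE; apply: eq_bigr => l _; rewrite mxE.
by rewrite uC mxE scale0r.
Qed.

Lemma quo_pi_zero S : \pi_(quo S) 0 = 0 :> quo S.
Proof.
by have := quo_piD S 0 0; rewrite addr0 -{1}[\pi_(quo S) 0]addr0 => /addrI.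
Qed.

Lemma quo_pi_sum S (I : Type) (r : seq I) (P : pred I) (F : I -> cps n v) :
  \pi_(quo S) (\sum_(k <- r | P k) F k) = \sum_(k <- r | P k) \pi_(quo S) (F k).
Proof.
exact: (big_morph _ (@quo_piD _ S) (quo_pi_zero S)).
Qed.

Lemma quo_pi0 S h : \pi_(quo S) h = 0 <-> ideal_gen S h.
Proof.
rewrite -(quo_pi_zero S); split=> [/eqP/quo_eqP|Sh]; first by rewrite subr0.
by apply/eqP/quo_eqP; rewrite subr0.
Qed.

(** The x are the monomials of degree l, one for each word of length l in the variables; repetitions
    do no harm. Indexing by an ordinal prepares for the matrices of [nakayama]. *)
Lemma ordge_gens l : exists (N : nat) (x : 'I_N -> cps n v),
  (forall k, ordge l (x k)) /\
  forall t h, ordge (l + t) h -> exists2 c : 'I_N -> cps n v,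
    (forall k, ordge t (c k)) & h = \sum_k c k * x k.
Proof.
suff [I [x [xl xh]]] : exists (I : finType) (x : I -> cps n v),
  (forall k, ordge l (x k)) /\
  forall t h, ordge (l + t) h -> exists2 c : I -> cps n v,
    (forall k, ordge t (c k)) & h = \sum_k c k * x k.
  exists #|I|, (x \o enum_val); split=> [k|t h /xh[c ct ->]]; first exact: xl.
  by exists (c \o enum_val) => [k|]; [exact: ct|rewrite big_enum_val].
elim: l => [|l [I [x [xl xh]]]].
  exists unit, (fun=> 1); split=> // t h ht; exists (fun=> h) => //.
  by rewrite (bigD1 tt) //= big1 ?addr0 ?mulr1 // => -[].
exists ('I_n * I)%type, (fun p => cps_var p.1 * x p.2); split=> [p|t h ht].
  by rewrite -add1n cpsM; apply: ordgeM => //; exact: ordge_var.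
have /choice[c cP] j : exists c : I -> cps n v,
    (forall k, ordge t (c k)) /\ cps_div j h = \sum_k c k * x k.
  have [|c ct cE] := xh t (cps_div j h); first exact: ordge_fdiv.
  by exists c.
exists (fun p => c p.1 p.2) => [p|]; first by have [] := cP p.1.
have h1 : ordge 1 h by exact: ordgeW ht.
rewrite [LHS]cps_decomp /cps_cst (proj1 (ordge1P _) h1) scale0r add0r.
rewrite (eq_bigr (fun j => \sum_k c j k * (cps_var j * x k))).
  by rewrite (pair_bigA _ (fun j k => c j k * (cps_var j * x k))).
move=> j _; have [_ ->] := cP j; rewrite mulr_sumr.
by apply: eq_bigr => k _; rewrite mulrCA.
Qed.

HB.instance Definition _ := GRing.isZmodMorphism.Build (cps n v) K cps_cst
  (fun f g => erefl).

Fact cps_cst_monoid : monoid_morphism (@cps_cst n R K v).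
Proof. by split=> [|f g]; [rewrite /cps_cst cps1 fps1 eqxx|exact: cps_cstM]. Qed.

HB.instance Definition _ := GRing.isMonoidMorphism.Build (cps n v) K cps_cst
  cps_cst_monoid.

(** The determinant trick: generators x of m^l satisfy (1 - M) x = s with s in the ideal and the
    entries of M in m. The determinant of 1 - M is 1 modulo m, hence a unit, and the adjugate
    expresses x by s. *)
Lemma nakayama S l :
    (forall h, ordge l h -> exists2 s, ideal_gen S s & ordge l.+1 (h - s : cps n v)) ->
  forall h, ordge l h -> ideal_gen S h.
Proof.
move=> HS; have [N [x [xl xh]]] := ordge_gens l.
have /choice[s sP] k : exists s : cps n v, ideal_gen S s /\ ordge l.+1 (x k - s : cps n v).
  by have [s] := HS _ (xl k); exists s.
have /choice[m mP] k : exists m : 'I_N -> cps n v,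
    (forall l', ordge 1 (m l')) /\ x k - s k = \sum_l' m l' * x l'.
  have [|m m1 mE] := xh 1%N (x k - s k); first by rewrite addn1; have [] := sP k.
  by exists m.
pose B : 'M[cps n v]_N := 1%:M - \matrix_(k, l') m k l'.
have BE : B *m (\col_k x k) = \col_k s k.
  apply/matrixP => k i; rewrite mulmxBl mul1mx !mxE.
  have [_ mE] := mP k; apply/eqP; rewrite subr_eq addrC -subr_eq mE; apply/eqP.
  by apply: eq_bigr => p _; rewrite !mxE.
have detB : \det B \is a GRing.unit.
  rewrite cps_unitE -det_map_mx (_ : map_mx _ B = 1%:M) ?det1 ?oner_eq0 //.
  rewrite map_mxB map_mx1 (_ : map_mx _ _ = 0) ?subr0 //.
  apply/matrixP => k i; rewrite !mxE; have [m1 _] := mP k.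
  exact: (proj1 (ordge1P _) (m1 i)).
have xS k : ideal_gen S (x k).
  have : \det B * x k = (\adj B *m (\col_k s k)) k 0.
    by rewrite -BE mulmxA mul_adj_mx mul_scalar_mx !mxE.
  move=> /(congr1 (fun y => (\det B)^-1 * y)); rewrite mulKr // => ->.
  apply: ideal_genMl; rewrite mxE; apply: ideal_gen_sum => i _.
  by apply: ideal_genMl; rewrite mxE; have [] := sP i.
move=> h hl; have [|c _ ->] := xh 0%N h; first by rewrite addn0.
by apply: ideal_gen_sum => k _; apply/ideal_genMl.
Qed.

(* If m^i + J > m^(i+1) + J for all i <= d, elements witnessing these d + 1 strict
   inclusions are linearly independent modulo J; otherwise Nakayama applies. *)
Lemma basis_ord S d (b : 'I_d -> quo S) : is_basis b ->
  forall h, ordge d h -> ideal_gen S h.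
Proof.
move=> bP; apply: contrapT => nS.
have /choice[a aP] (k : 'I_d.+1) : exists h, ordge k h /\
    forall s, ideal_gen S s -> ~ ordge k.+1 (h - s : cps n v).
  apply: contrapT => nk; apply: nS => h hd; apply: (@nakayama S k).
    move=> {hd}h hk; apply: contrapT => ns; apply: nk; exists h; split=> // s Ss hs.
    by apply: ns; exists s.
  by apply: ordgeW hd; rewrite -ltnS.
have [u u0 uE] := basis_dependent (fun k => \pi_(quo S) (a k)) bP.
pose x := \sum_k u 0 k *: a k.
have Sx : ideal_gen S x.
  apply/quo_pi0; rewrite quo_pi_sum -[RHS]uE.
  by apply: eq_bigr => k _; rewrite quo_piZ.
have [k0 uk0] : exists k, u 0 k != 0.
  apply/existsP; rewrite -negb_forall; apply: contra u0 => /forallP u0.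
  by apply/eqP/rowP => k; rewrite mxE; apply/eqP.
(* For the least index k with nonzero coefficient, the relation puts [a k] into the ideal modulo
   m^(k+1), against its choice. *)
have [k uk kmin] := @arg_minnP _ k0 (fun k => u 0 k != 0) (fun k => val k) uk0.
have [ak nak] := aP k; apply: (nak ((u 0 k)^-1 *: x)).
  by rewrite -mulr_algl; exact: ideal_genMl.
rewrite /x (bigD1 k) //= scalerDr scalerA mulVf // scale1r opprD addrA subrr add0r.
set y := \sum_(i < _ | _) _; suff yo : ordge k.+1 y.
  exact: (ordgeN (@ordgeZ _ _ _ (u 0 k)^-1 _ yo)).
rewrite /y cps_sum; apply: ordge_sum => l lk.
have [->|ul] := eqVneq (u 0 l) 0; first by rewrite scale0r.
rewrite cpsZ; apply: ordgeZ; have [al _] := aP l; apply: ordgeW al.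
by rewrite ltn_neqAle eq_sym lk kmin.
Qed.

End Dimension.

(** * Automorphisms and isomorphisms of quotients *)

Section Automorphisms.
Context {n : nat} {R : realType} {K : fieldType} {v : absValue R K}.
Implicit Types (f g h : cps n v) (i j : 'I_n) (S : set (cps n v)) (k N : nat).
Implicit Types (phi psi : {lrmorphism cps n v -> cps n v}).

Lemma cps_derivD i f g : cps_deriv i (f + g) = cps_deriv i f + cps_deriv i g.
Proof. by apply: cps_inj; rewrite /= fps_derivD. Qed.

Lemma cps_derivM i f g :
  cps_deriv i (f * g) = cps_deriv i f * g + f * cps_deriv i g.
Proof. by apply: cps_inj; rewrite /= fps_derivM. Qed.

Lemma cps_deriv_alg i (a : K) : cps_deriv i (a%:A : cps n v) = 0.
Proof. by apply: cps_inj; rewrite /= fps_derivZ fps_deriv1 scaler0. Qed.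

(** The difference of the two sides is a derivation that kills constants and variables, so [rec_eq0]
    applies to it. *)
Lemma derivation_expand (D : cps n v -> cps n v) f :
    (forall g h, D (g + h) = D g + D h) ->
    (forall g h, D (g * h) = D g * h + g * D h) ->
    (forall a : K, D (a%:A) = 0) ->
  D f = \sum_j D (cps_var j) * cps_deriv j f.
Proof.
move=> DD DM DA; have D0 : D 0 = 0 by have := DA 0; rewrite scale0r.
have rec (D' : cps n v -> cps n v) : (forall g h, D' (g + h) = D' g + D' h) ->
    (forall g h, D' (g * h) = D' g * h + g * D' h) -> (forall a : K, D' (a%:A) = 0) ->
    forall g, D' g = \sum_j (D' (cps_var j) * cps_div j g + cps_var j * D' (cps_div j g)).
  move=> D'D D'M D'A g; have D'0 : D' 0 = 0 by have := D'A 0; rewrite scale0r.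
  rewrite {1}[g]cps_decomp D'D D'A add0r (big_morph D' D'D D'0).
  by apply: eq_bigr => j _; rewrite D'M.
have var_deriv i j : cps_deriv i (cps_var j : cps n v) = (i == j)%:R.
  apply: cps_inj; rewrite /= -[fps_var j]mulr1 fps_deriv_varM fps_deriv1 mulr0 addr0.
  by case: eqP => _; rewrite ?scale1r ?scale0r.
pose E g : fps n K := D g - \sum_j D (cps_var j) * cps_deriv j g.
suff Ef g : E g = 0.
  by apply: cps_inj; apply/eqP; rewrite -subr_eq0; apply/eqP/(Ef f).
move: g; apply: (rec_eq0 (dv := @cps_div _ _ _ _) (u := fps_var)) => [j|g].
  exact: ordge_var.
suff H : D g - \sum_j D (cps_var j) * cps_deriv j g = \sum_j cps_var j *
    (D (cps_div j g) - \sum_i D (cps_var i) * cps_deriv i (cps_div j g)).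
  by rewrite /E H cps_sum.
rewrite (rec D) //.
under [X in _ - X]eq_bigr => i _.
  rewrite (rec (cps_deriv i) (cps_derivD i) (cps_derivM i) (cps_deriv_alg i)).
  under eq_bigr => j _ do rewrite var_deriv.
  rewrite big_split /= (bigD1 i) //= eqxx mul1r [X in _ + X + _]big1 ?addr0; last first.
    by move=> j; rewrite eq_sym => /negbTE->; rewrite mul0r.
  rewrite mulrDr mulr_sumr; over.
rewrite !big_split /= opprD addrACA subrr add0r exchange_big -sumrB /=.
apply: eq_bigr => j _; rewrite mulrBr mulr_sumr; congr (_ - _).
by apply: eq_bigr => i _; rewrite mulrCA.
Qed.

(* The derivation phi \o cps_deriv i \o phi^-1 is a combination of the partial derivatives:
   this is the chain rule, obtained without writing phi as a substitution. *)
Lemma aut_deriv phi g i : local_aut phi -> exists c : 'I_n -> cps n v,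
  phi (cps_deriv i g) = \sum_j c j * cps_deriv j (phi g).
Proof.
move=> /local_aut_inv[psi [_ phiK psiK]].
pose D h := phi (cps_deriv i (psi h)).
exists (fun j => D (cps_var j)); rewrite -(@derivation_expand D).
- by rewrite /D phiK.
- by move=> f h; rewrite /D rmorphD cps_derivD rmorphD.
- by move=> f h; rewrite /D rmorphM cps_derivM rmorphD !rmorphM /= !psiK.
- by move=> a; rewrite /D rmorph_alg cps_deriv_alg rmorph0.
Qed.

Lemma milnor_relsP k f h : milnor_rels k f h <->
  exists2 c : 'I_n -> cps n v, (forall i, ordge k (c i)) & h = \sum_i c i * cps_deriv i f.
Proof. exact: ideal_exp_mulP. Qed.

Lemma gen_milnor_rels k f h : ideal_gen (milnor_rels k f) h <-> milnor_rels k f h.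
Proof. exact: ideal_gen_idem. Qed.

Lemma gen_tjurina_relsP k f h : ideal_gen (tjurina_rels k f) h <->
  exists a y, milnor_rels k f y /\ h = a * f + y.
Proof.
rewrite /tjurina_rels ideal_genU1P; split=> -[a [y [yP ->]]]; exists a, y; split=> //.
  exact/gen_milnor_rels.
exact/gen_milnor_rels.
Qed.

Lemma aut_milnor_rels phi k g h : local_aut phi ->
  milnor_rels k g h -> milnor_rels k (phi g) (phi h).
Proof.
move=> phil /milnor_relsP[c ck ->]; apply/milnor_relsP.
have /choice[D DE] i := aut_deriv g i phil.
exists (fun j => \sum_i phi (c i) * D i j) => [j|].
  rewrite cps_sum; apply: ordge_sum => i _; rewrite cpsM; apply: ordgeMr.
  exact: local_aut_ord.
rewrite rmorph_sum; under eq_bigr => i _ do rewrite rmorphM /= DE mulr_sumr.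
rewrite exchange_big /=; apply: eq_bigr => j _; rewrite mulr_suml.
by apply: eq_bigr => i _; rewrite mulrA.
Qed.

(** The partial derivatives of phi g = u^-1 f are d(u^-1) f + u^-1 df: the unit contributes only
    multiples of f, which the generator f of the ideal absorbs. *)
Lemma aut_tjurina_rels phi k f g u h : local_aut phi -> u \is a GRing.unit ->
  f = u * phi g -> ideal_gen (tjurina_rels k g) h -> ideal_gen (tjurina_rels k f) (phi h).
Proof.
move=> phil uU fE /gen_tjurina_relsP[a [y [yP ->]]].
have gE : phi g = u^-1 * f by rewrite fE mulKr.
have := aut_milnor_rels phil yP; rewrite gE => /milnor_relsP[c ck yE].
rewrite rmorphD rmorphM /= gE yE; apply/gen_tjurina_relsP.
exists (phi a * u^-1 + \sum_i c i * cps_deriv i u^-1), (\sum_i c i * u^-1 * cps_deriv i f).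
split.
  apply/milnor_relsP; exists (fun i => c i * u^-1) => // i.
  by rewrite cpsM; exact: ordgeMr.
under eq_bigr => i _ do rewrite cps_derivM mulrDr.
rewrite big_split /= mulrDl mulr_suml -!addrA -mulrA; congr (_ + (_ + _)).
  by apply: eq_bigr => i _; rewrite mulrA.
by apply: eq_bigr => i _; rewrite mulrA.
Qed.

Lemma quo_iso phi psi S S' : cancel phi psi -> cancel psi phi ->
    (forall h, ideal_gen S h -> ideal_gen S' (phi h)) ->
    (forall h, ideal_gen S' h -> ideal_gen S (psi h)) ->
  exists2 F : quo S -> quo S', alg_iso F & forall h, F (\pi_(quo S) h) = \pi_(quo S') (phi h).
Proof.
move=> phiK psiK SS' S'S; pose F (x : quo S) := \pi_(quo S') (phi (repr x)).
pose F' (x : quo S') := \pi_(quo S) (psi (repr x)).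
have FE h : F (\pi_(quo S) h) = \pi_(quo S') (phi h).
  apply/eqP/quo_eqP; rewrite -rmorphB; apply: SS'.
  by apply/quo_eqP; rewrite reprK.
have F'E h : F' (\pi_(quo S') h) = \pi_(quo S) (psi h).
  apply/eqP/quo_eqP; rewrite -rmorphB; apply: S'S.
  by apply/quo_eqP; rewrite reprK.
exists F => //; split; first exists F'.
- by elim/(@quo_ind _ S) => h; rewrite FE F'E phiK.
- by elim/(@quo_ind _ S') => h; rewrite F'E FE psiK.
- move=> a; elim/(@quo_ind _ S) => x; elim/(@quo_ind _ S) => y.
  have -> : a *: \pi_(quo S) x = \pi_(quo S) (a *: x) by exact/esym/quo_piZ.
  by rewrite -quo_piD !FE rmorphD /= linearZZ quo_piD; congr (_ + _); exact: quo_piZ.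
- split; first exact: etrans (FE 1) (congr1 _ (rmorph1 phi)).
  elim/(@quo_ind _ S) => x; elim/(@quo_ind _ S) => y.
  have -> : \pi_(quo S) x * \pi_(quo S) y = \pi_(quo S) (x * y) by exact/esym/quo_piM.
  by rewrite !FE rmorphM; exact: quo_piM.
Qed.

Lemma contact_tjurina_iso k f g : contact_equiv f g -> tjurina_iso k f g.
Proof.
move=> [phi phil [u uU fE]]; have [psi [psil phiK psiK]] := local_aut_inv phil.
have [||F F_iso _] := @quo_iso psi phi (tjurina_rels k f) (tjurina_rels k g) psiK phiK.
- move=> h; apply: (aut_tjurina_rels (u := (psi u)^-1)) => //.
    by rewrite unitrV rmorph_unit.
  by rewrite fE rmorphM /= phiK mulKr // rmorph_unit.
- by move=> h; exact: (aut_tjurina_rels phil uU fE).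
- by exists F.
Qed.

Lemma right_milnor_iso k f g : right_equiv f g -> milnor_iso k f g.
Proof.
move=> [phi phil fE]; have [psi [psil phiK psiK]] := local_aut_inv phil.
have [||F F_iso FE] := @quo_iso psi phi (milnor_rels k f) (milnor_rels k g) psiK phiK.
- move=> h /gen_milnor_rels hf; apply/gen_milnor_rels.
  by have := aut_milnor_rels psil hf; rewrite fE phiK.
- move=> h /gen_milnor_rels hg; apply/gen_milnor_rels.
  by have := aut_milnor_rels phil hg; rewrite -fE.
- by exists F => //; rewrite FE fE phiK.
Qed.

(** * Lifting isomorphisms of quotients to automorphisms of K{x} *)

Section Lifting.

Lemma coef1M (w q : fps n K) j : ordge 1 w -> (w * q) U_(j)%MM = w U_(j)%MM * q 0%MM.
Proof.
move=> w1; pose q1 : fps n K := q - (q 0%MM)%:A.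
have qE : w * q = w * q1 + q 0%MM *: w.
  by rewrite /q1 mulrBr -scalerAr mulr1 subrK.
have q1o : ordge 1 q1 by apply/ordge1P; rewrite /q1 fpsD fpsN fpsZ fps1 eqxx mulr1 subrr.
by rewrite qE fpsD fpsZ (ordgeM w1 q1o) ?mdeg1 // add0r mulrC.
Qed.

(** The chain rule at the origin: linear parts compose like matrices. *)
Lemma fsub_coef1 (w : 'I_n -> fps n K) (f : fps n K) j :
  (forall i, ordge 1 (w i)) -> ordge 1 f ->
  fsub w f U_(j)%MM = \sum_i f U_(i)%MM * w i U_(j)%MM.
Proof.
move=> w1 f1; rewrite fsub_rec // (proj1 (ordge1P _) f1) scale0r add0r fps_sum.
apply: eq_bigr => i _; rewrite coef1M // mulrC; congr (_ * _).
rewrite fsub_rec // fpsD fpsZ fps1 eqxx mulr1 fps_sum big1 ?addr0 => [|k _].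
  by rewrite /fdiv add0m; case: forallP => // -[] k; rewrite mnm0E eqxx implybT.
by rewrite (proj1 (ordge1P _)) //; exact: ordgeMr.
Qed.

Lemma ordge2P (f : fps n K) : ordge 1 f -> (forall j, f U_(j)%MM = 0) -> ordge 2 f.
Proof.
move=> f1 fU m; rewrite ltnS leq_eqVlt => /orP[|/f1//].
by move=> /mdeg1P[i /eqP ->]; exact: fU.
Qed.

Variables (S S' : set (cps n v)) (F : quo S -> quo S').

Lemma alg_iso_inv : alg_iso F ->
  exists F' : quo S' -> quo S, [/\ alg_iso F', cancel F F' & cancel F' F].
Proof.
move=> [[F' FK F'K] Flin [F1 FM]]; exists F'; split=> //; split; first by exists F.
- by move=> a x y; apply: (can_inj FK); rewrite F'K Flin !F'K.
- split; first by apply: (can_inj FK); rewrite F'K F1.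
  by move=> x y; apply: (can_inj FK); rewrite F'K FM !F'K.
Qed.

Hypothesis F_iso : alg_iso F.

Lemma alg_isoD x y : F (x + y) = F x + F y.
Proof. by have [_ + _] := F_iso; move=> /(_ 1 x y); rewrite !scale1r. Qed.

Lemma alg_iso0 : F 0 = 0.
Proof. by have := alg_isoD 0 0; rewrite addr0 -{1}[F 0]addr0 => /addrI. Qed.

Lemma alg_iso_sum (I : Type) (r : seq I) (E : I -> cps n v) :
  F (\pi_(quo S) (\sum_(k <- r) E k)) = \sum_(k <- r) F (\pi_(quo S) (E k)).
Proof. by rewrite quo_pi_sum (big_morph F alg_isoD alg_iso0). Qed.

Lemma alg_isoM a b a' b' : F (\pi_(quo S) a) = \pi_(quo S') a' ->
  F (\pi_(quo S) b) = \pi_(quo S') b' ->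
  F (\pi_(quo S) (a * b)) = \pi_(quo S') (a' * b').
Proof.
move=> Fa Fb; have [_ _ [_ FM]] := F_iso.
have -> : \pi_(quo S) (a * b) = \pi_(quo S) a * \pi_(quo S) b by exact: quo_piM.
by rewrite FM Fa Fb; exact/esym/quo_piM.
Qed.

Lemma alg_iso1 : F (\pi_(quo S) 1) = \pi_(quo S') 1.
Proof. by have [_ _ [F1 _]] := F_iso. Qed.

(** Were h' a unit, some e would satisfy e h = 1 modulo S, and as h and S lie in m, so would 1. *)
Lemma alg_iso_local h h' : (forall x, ideal_gen S x -> ordge 1 x) -> ordge 1 h ->
  F (\pi_(quo S) h) = \pi_(quo S') h' -> ordge 1 h'.
Proof.
move=> S1 h1 Fh; apply/ordge1_unit/negP => h'U.
have [[F' FK F'K] _ _] := F_iso.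
pose e := repr (F' (\pi_(quo S') h'^-1)).
have Fe : F (\pi_(quo S) e) = \pi_(quo S') h'^-1 by rewrite reprK F'K.
have := alg_isoM Fe Fh; rewrite mulVr // -alg_iso1 => /(can_inj FK)/eqP/quo_eqP/S1.
move=> eh; have : ordge 1 ((1 : cps n v) : fps n K).
  rewrite (_ : (1 : cps n v) = e * h - (e * h - 1)); last by ring.
  by rewrite cpsD cpsN; apply: ordgeB => //; rewrite cpsM; exact: ordgeMl.
by move=> /ordge1_unit; rewrite unitr1.
Qed.

Lemma alg_iso_proper : (forall x, ideal_gen S x -> ordge 1 x) ->
  forall x, ideal_gen S' x -> ordge 1 x.
Proof.
move=> S1 x S'x; apply/ordge1_unit/negP => xU.
have [[F' FK F'K] _ _] := F_iso.
have : \pi_(quo S') 1 = 0 by apply/quo_pi0; rewrite -(mulVr xU); exact: ideal_genMl.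
rewrite -alg_iso1 -alg_iso0 => /(can_inj FK)/quo_pi0/S1/ordge1_unit.
by rewrite unitr1.
Qed.

Lemma alg_iso_ord N h : (forall x, ideal_gen S x -> ordge 1 x) -> ordge N h ->
  exists2 r, ordge N (r : cps n v) & F (\pi_(quo S) h) = \pi_(quo S') r.
Proof.
move=> S1; elim: N h => [|N IH] h hN.
  by exists (repr (F (\pi_(quo S) h))); [exact: ordge_trivial|rewrite reprK].
have h1 : ordge 1 h by exact: ordgeW hN.
pose u i := repr (F (\pi_(quo S) (cps_var i))).
have uE i : F (\pi_(quo S) (cps_var i)) = \pi_(quo S') (u i) by rewrite reprK.
have u1 i : ordge 1 (u i) by apply: alg_iso_local (uE i) => //; exact: ordge_var.
have /choice[r rP] i : exists r : cps n v, ordge N r /\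
    F (\pi_(quo S) (cps_div i h)) = \pi_(quo S') r.
  by have [|r] := IH (cps_div i h); [exact: ordge_fdiv|exists r].
exists (\sum_i u i * r i).
  rewrite cps_sum; apply: ordge_sum => i _; rewrite cpsM -add1n.
  by apply: ordgeM => //; have [] := rP i.
rewrite [h]cps_decomp /cps_cst (proj1 (ordge1P _) h1) scale0r add0r alg_iso_sum quo_pi_sum.
by apply: eq_bigr => i _; apply: alg_isoM => //; have [] := rP i.
Qed.

(** Let u lift the images of the variables. By induction on k, F and the substitution of u agree up
    to an error of order k; for k = N the error vanishes modulo [S']. *)
Lemma alg_iso_subst N : (forall x, ideal_gen S x -> ordge 1 x) ->
    (forall x : cps n v, ordge N x -> ideal_gen S' x) ->
  exists (u : 'I_n -> cps n v) (u1 : forall i, ordge 1 (u i)),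
    forall h, F (\pi_(quo S) h) = \pi_(quo S') (cps_subst u1 h).
Proof.
move=> S1 S'N; pose u i := repr (F (\pi_(quo S) (cps_var i))).
have uE i : F (\pi_(quo S) (cps_var i)) = \pi_(quo S') (u i) by rewrite reprK.
have u1 i : ordge 1 (u i) by apply: alg_iso_local (uE i) => //; exact: ordge_var.
exists u, u1 => h.
suff H k : exists2 r, ordge k (r : cps n v) &
    F (\pi_(quo S) h) = \pi_(quo S') (cps_subst u1 h + r).
  have [r /S'N/quo_pi0 r0 ->] := H N.
  by rewrite [LHS]quo_piD r0 addr0.
elim: k h => [|k IH] h.
  exists (repr (F (\pi_(quo S) h)) - cps_subst u1 h); first exact: ordge_trivial.
  by rewrite addrC subrK reprK.
have /choice[r rP] i : exists r : cps n v, ordge k r /\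
    F (\pi_(quo S) (cps_div i h)) = \pi_(quo S') (cps_subst u1 (cps_div i h) + r).
  by have [r] := IH (cps_div i h); exists r.
exists (\sum_i u i * r i).
  rewrite cps_sum; apply: ordge_sum => i _; rewrite cpsM -add1n.
  by apply: ordgeM => //; have [] := rP i.
rewrite (lrmorph_rec _ h) {1}[h]cps_decomp -addrA -big_split quo_piD alg_isoD [RHS]quo_piD.
congr (_ + _).
  have piZ S0 : \pi_(quo S0) (cps_cst h)%:A = cps_cst h *: \pi_(quo S0) 1 by exact: quo_piZ.
  rewrite !piZ; have [_ + _] := F_iso; move=> /(_ (cps_cst h) (\pi_(quo S) 1) 0).
  by rewrite alg_iso0 !addr0 alg_iso1.
rewrite alg_iso_sum [RHS]quo_pi_sum; apply: eq_bigr => i _.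
rewrite cps_subst_var /= -mulrDr; apply: alg_isoM => //.
by have [] := rP i.
Qed.

End Lifting.

(** Lifts of F and of its inverse are mutually inverse only modulo the ideals. Since S lies in m^2,
    the composite inducing the identity on [quo S] is the identity up to order 2, and [subst_bij]
    makes it bijective. *)
Lemma alg_iso_lift S S' (F : quo S -> quo S') N : alg_iso F ->
    (forall x, ideal_gen S x -> ordge 2 x) -> (forall x : cps n v, ordge N x -> ideal_gen S x) ->
  exists2 phi : {lrmorphism cps n v -> cps n v}, local_aut phi &
    forall h, F (\pi_(quo S) h) = \pi_(quo S') (phi h).
Proof.
move=> F_iso S2 SN; have [F' [F'_iso FK F'K]] := alg_iso_inv F_iso.
have S1 x : ideal_gen S x -> ordge 1 x by move=> /S2; exact: ordgeW.
have S'1 := alg_iso_proper F_iso S1.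
have S'N (x : cps n v) : ordge N x -> ideal_gen S' x.
  move=> /(alg_iso_ord F'_iso S'1)[r /SN/quo_pi0 r0 F'x].
  by apply/quo_pi0; apply: (can_inj F'K); rewrite F'x r0 (alg_iso0 F'_iso).
have [u [u1 uE]] := alg_iso_subst F_iso S1 S'N.
have [w [w1 wE]] := alg_iso_subst F'_iso S'1 SN.
exists (cps_subst u1) => //; apply: local_aut_subst.
have wu2 i : ordge 2 (((cps_subst w1 (u i) : cps n v) : fps n K) - fps_var i).
  apply: (S2 (cps_subst w1 (u i) - cps_var i)); apply/quo_eqP.
  by rewrite -(cps_subst_var u1) -wE -uE FK.
pose A : 'M[K]_n := \matrix_(i, j) (u i : fps n K) U_(j)%MM.
pose B : 'M[K]_n := \matrix_(i, j) (w i : fps n K) U_(j)%MM.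
have varU i j : (fps_var i : fps n K) U_(j)%MM = (i == j)%:R.
  by rewrite /fps_var eq_mnm1 eq_sym.
have AB : A *m B = 1%:M.
  apply/matrixP => i j; rewrite !mxE.
  transitivity (fsub (fun i => w i : fps n K) (u i) U_(j)%MM).
    by rewrite fsub_coef1 //; apply: eq_bigr => l _; rewrite !mxE.
  rewrite -varU; apply/eqP; rewrite -subr_eq0; apply/eqP.
  by apply: (wu2 i); rewrite mdeg1.
(* The other composite is the identity modulo [S'], which at this point is only known to lie in m.
   Its linear part is [B *m A], and this is 1 because a one-sided inverse of a square matrix is
   two-sided. *)
have uw2 i : ordge 2 (((cps_subst u1 (w i) : cps n v) : fps n K) - fps_var i).
  have o1 : ordge 1 (((cps_subst u1 (w i) : cps n v) : fps n K) - fps_var i).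
    by apply: ordgeB; [exact: ordge_fsub|exact: ordge_var].
  apply: ordge2P => // j; rewrite fpsD fpsN varU cps_substE fsub_coef1 //.
  have := congr1 (fun M : 'M[K]_n => M i j) (mulmx1C AB); rewrite !mxE => <-.
  rewrite -sumrB big1 // => l _; by rewrite !mxE subrr.
have comp_bij (p q : 'I_n -> cps n v) (p1 : forall i, ordge 1 (p i))
    (q1 : forall i, ordge 1 (q i)) :
    (forall i, ordge 2 (((cps_subst q1 (p i) : cps n v) : fps n K) - fps_var i)) ->
  bijective (cps_subst q1 \o cps_subst p1).
  move=> qp2; have qp1 i : ordge 1 (cps_subst q1 (p i)) by exact: ordge_fsub.
  apply: eq_bij (subst_bij qp1 qp2) _ _ => h.
  by apply: cps_inj; rewrite /= fsub_comp.
have [c cK _] := comp_bij _ _ u1 w1 wu2.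
have [d _ dK] := comp_bij _ _ w1 u1 uw2.
exists (c \o cps_subst w1) => [h|h]; first exact: cK.
rewrite -[in LHS](dK h) /= [c _](cK (cps_subst w1 (d h))).
exact: dK.
Qed.

End Automorphisms.

(** * The Mather-Yau theorem *)

Section MatherYau.
Context {n : nat} {R : realType} {K : fieldType} {v : absValue R K}.
Implicit Types (f g h : cps n v) (i j : 'I_n) (k d o : nat).
Implicit Types (phi psi : {lrmorphism cps n v -> cps n v}).

Lemma cps_ordE f : f != 0 -> exists o,
  [/\ ordge o f, ~ ordge o.+1 f & cps_ord f = o%:R%:E].
Proof.
move=> f0; have exN : exists k, `[<~ ordge k f>].
  apply: contrapT => nk; case/eqP: f0; apply: cps_inj; apply: ordge_eq0 => k.
  by apply: contrapT => nfk; apply: nk; exists k; apply/asboolP.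
case: (ex_minnP exN) => -[/asboolP[]//|o /asboolP no omin].
have fo : ordge o f.
  by apply: contrapT => /asboolP/omin; rewrite ltnn.
exists o; split=> //; apply/eqP; rewrite eq_le; apply/andP; split.
  apply: ge_ereal_sup => _ [l /ideal_exp_maxP fl <-].
  rewrite lee_fin ler_nat leqNgt; apply/negP => ol; apply: no.
  exact: ordgeW fl.
by apply: ereal_sup_ubound; exists o => //; exact/ideal_exp_maxP.
Qed.

Lemma cps_ord0 : cps_ord (0 : cps n v) = +oo%E.
Proof.
apply/eqyP => r r0; apply: (@le_trans _ _ (Num.bound r)%:R%:E).
  by rewrite lee_fin ltW // archi_boundP // ltW.
by apply: ereal_sup_ubound; exists (Num.bound r) => //; exact/ideal_exp_maxP.
Qed.

(** Some quotient of f by a variable has order exactly one less, since otherwise the decomposition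
    of f would raise its order; this is repeated t times. *)
Lemma ordge_exact t f k : ordge (k + t) f -> ~ ordge (k + t).+1 f ->
  exists2 h : cps n v, ordge k h & ~ ordge k.+1 h.
Proof.
elim: t f => [|t IH] f; first by rewrite addn0; exists f.
rewrite addnS => fo nfo; apply: contrapT => nh; apply: nfo.
have f1 : ordge 1 f by exact: ordgeW fo.
rewrite [f]cps_decomp /cps_cst (proj1 (ordge1P _) f1) scale0r add0r cps_sum.
apply: ordge_sum => i _; rewrite cpsM -add1n; apply: ordgeM; first exact: ordge_var.
apply: contrapT => ni; apply: nh; apply: (IH (cps_div i f)) => //.
exact: ordge_fdiv.
Qed.

Lemma ordge_mul_gens (chi : K) f d :
    (forall x : cps n v, ordge d x -> exists (b : cps n v) (c : 'I_n -> cps n v),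
       x = chi *: (b * f) + \sum_i c i * cps_deriv i f) ->
  forall a (q : cps n v), ordge (a + d) q ->
    exists (w : cps n v) (y : 'I_n -> cps n v),
      [/\ ordge a w, forall i, ordge a (y i) &
          q = chi *: (w * f) + \sum_i y i * cps_deriv i f].
Proof.
move=> Hd a q; rewrite addnC => qo; have [N [x [xd xq]]] := @ordge_gens n R K v d.
have [c ca ->] := xq _ _ qo.
have /choice[b /choice[e xE]] : forall l, exists b c, x l = _ := fun l => Hd _ (xd l).
exists (\sum_l c l * b l), (fun i => \sum_l c l * e l i); split.
- by rewrite cps_sum; apply: ordge_sum => l _; rewrite cpsM; apply/ordgeMr/ca.
- by move=> i; rewrite cps_sum; apply: ordge_sum => l _; rewrite cpsM; apply/ordgeMr/ca.
rewrite mulr_suml scaler_sumr.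
under [X in _ = _ + X]eq_bigr => i _ do rewrite mulr_suml.
rewrite exchange_big -big_split; apply: eq_bigr => l _ /=.
rewrite [x l]xE mulrDr -scalerAr mulrA mulr_sumr; congr (_ + _).
by apply: eq_bigr => i _; rewrite mulrA.
Qed.

Lemma milnor_rels_ord k f h o : ordge o.+1 f -> milnor_rels k f h -> ordge (k + o) h.
Proof.
move=> fo /milnor_relsP[c ck ->]; rewrite cps_sum; apply: ordge_sum => i _.
by rewrite cpsM; apply: ordgeM => //; exact: ordge_deriv.
Qed.

Lemma finitely_determined (chi : K) f h d o :
    (forall x : cps n v, ordge d x -> exists (b : cps n v) (c : 'I_n -> cps n v),
       x = chi *: (b * f) + \sum_i c i * cps_deriv i f) ->
    ordge o.+2 f -> (o < d)%N -> ordge (d + d - o).+1 h ->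
  exists2 phi : {lrmorphism cps n v -> cps n v}, local_aut phi &
    exists2 w : cps n v, ordge 1 w & (1 + chi *: w) * phi f = f + h.
Proof.
(* Two demands determine a: D = a + d, so that m^D lies in m^a times the ideal, and D + 1 = o + 2 a,
   so that the quadratic remainder gains one order. The hypothesis o < d gives a > 1. *)
move=> Hd fo od hD; set a := (d.+1 - o)%N.
have a1 : (1 < a)%N by rewrite /a; move: od; clear; lia.
have DE : (a + d).+1 = (o + a + a)%N by rewrite /a; move: od; clear; lia.
have hD' : ordge (a + d) h by apply: ordgeW hD; rewrite /a; move: od; clear; lia.
have [w [y [w1 y2 E]]] := determinacy a1 DE fo hD' (fun q => ordge_mul_gens Hd (q := q)).
pose u i := cps_var i + y i.
have y1 i : ordge 1 (y i) by exact: ordgeW (y2 i).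
have u1 i : ordge 1 (u i) by rewrite /u cpsD; apply: ordgeD => //; exact: ordge_var.
have uX i : ordge 2 ((u i : fps n K) - fps_var i) by rewrite /u cpsD addrC addKr.
exists (cps_subst u1); first exact/local_aut_subst/subst_bij.
by exists w => //; apply: cps_inj; exact: E.
Qed.

Lemma local_aut_id : local_aut (idfun : {lrmorphism cps n v -> cps n v}).
Proof. by split=> //; exists id. Qed.

(** A variable is not a zero divisor, so none of its powers vanishes: m^d = 0 leaves no variables at
    all. This settles f = 0, where the ideal of finite codimension is 0. *)
Lemma ordge1_eq0 d : (forall h : cps n v, ordge d h -> h = 0) ->
  forall h : cps n v, ordge 1 h -> h = 0.
Proof.
move=> d0 h h1; rewrite [h]cps_decomp /cps_cst (proj1 (ordge1P _) h1) scale0r add0r.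
apply: big1 => i _.
have Xd : (cps_var i : cps n v) ^+ d = 0.
  apply: d0; have -> : ((cps_var i ^+ d : cps n v) : fps n K) = fps_var i ^+ d.
    by elim: d => // k IH; rewrite !exprS cpsM IH.
  by rewrite -{1}[d]mul1n; apply: ordgeX; exact: ordge_var.
have X_reg f : (cps_var i : cps n v) * f = 0 -> f = 0.
  move=> Xf; apply: cps_inj; apply/funext => m.
  have := congr1 (fun q : cps n v => (q : fps n K) (m + U_(i))%MM) Xf.
  by rewrite cpsM fps_varM mnmDE mnm1E eqxx addn1 /= addmK.
suff : (1 : cps n v) = 0 by move=> /eqP; rewrite oner_eq0.
elim: d Xd {d0} => [|d IH]; first by rewrite expr0.
by rewrite exprS => /X_reg.
Qed.

Lemma jacobian_idealP f h : jacobian_ideal f h <->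
  exists c : 'I_n -> cps n v, h = \sum_i c i * cps_deriv i f.
Proof. exact: ideal_gen_rangeP. Qed.

Lemma cps_deriv0 i : cps_deriv i (0 : cps n v) = 0.
Proof. by have := cps_deriv_alg (v := v) i 0; rewrite scale0r. Qed.

Section Converse.
Variables (chi : K) (f : cps n v) (k d o : nat).
Hypotheses (f_ord : ordge o.+2 f) (f_nord : ~ ordge o.+3 f).
Hypothesis d_gens : forall x : cps n v, ordge d x ->
  exists (b : cps n v) (c : 'I_n -> cps n v),
    x = chi *: (b * f) + \sum_i c i * cps_deriv i f.

(* Otherwise m^d, d <= ord f - 2, would lie in <f, j(f)>, hence in m^(ord f - 1). *)
Lemma ord_lt_codim : (o < d)%N.
Proof.
rewrite ltnNge; apply/negP => dle.
have [||x xd nxd] := @ordge_exact (o.+2 - d) f d; rewrite ?subnKC //; try by lia.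
have [b [c xE]] := d_gens xd; apply: nxd.
apply: (@ordgeW _ _ o.+1); first by lia.
rewrite xE cpsD cpsZ cpsM cps_sum; apply: ordgeD.
  by apply/ordgeZ/ordgeMl; exact: ordgeW f_ord.
by apply: ordge_sum => i _; rewrite cpsM; apply/ordgeMl/ordge_deriv.
Qed.

(** The bound k >= 2(d - ord f + 2) for ord f = o + 2, cleared of subtraction. *)
Hypothesis kdo : (d + d <= k + o + o)%N.

Lemma exponent_gt1 : (1 < k)%N.
Proof. by have := ord_lt_codim; lia. Qed.

Lemma milnor_rels_ord2 h : milnor_rels k f h -> ordge 2 h.
Proof.
by move=> /(milnor_rels_ord f_ord); apply: ordgeW; have := exponent_gt1; lia.
Qed.

End Converse.

Lemma tjurina_iso_contact f g k d o :
    ordge o.+2 f -> ~ ordge o.+3 f -> (d + d <= k + o + o)%N ->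
    (forall x : cps n v, ordge d x -> ideal_gen (f |` jacobian_ideal f) x) ->
  tjurina_iso k f g -> contact_equiv f g.
Proof.
move=> fo nfo kdo dJ [F F_iso].
have d_gens (x : cps n v) : ordge d x -> exists (b : cps n v) (c : 'I_n -> cps n v),
    x = 1 *: (b * f) + \sum_i c i * cps_deriv i f.
  move=> /dJ/ideal_genU1P[b [y [/ideal_gen_idem/jacobian_idealP[c ->] ->]]].
  by exists b, c; rewrite scale1r.
have od := ord_lt_codim fo nfo d_gens; have k1 := exponent_gt1 fo nfo d_gens kdo.
have S2 x : ideal_gen (tjurina_rels k f) x -> ordge 2 x.
  move=> /gen_tjurina_relsP[a [y [/(milnor_rels_ord2 fo nfo d_gens kdo) y2 ->]]].
  rewrite cpsD; apply: ordgeD => //; rewrite cpsM; apply: ordgeMl.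
  exact: ordgeW fo.
have SN (x : cps n v) : ordge (k + d) x -> ideal_gen (tjurina_rels k f) x.
  move=> /(ordge_mul_gens d_gens)[w [y [_ yk ->]]].
  apply/gen_tjurina_relsP; exists w, (\sum_i y i * cps_deriv i f).
  by rewrite scale1r; split=> //; apply/milnor_relsP; exists y.
have [phi phil FE] := alg_iso_lift F_iso S2 SN.
have [psi [psil phiK psiK]] := local_aut_inv phil.
have [F' [_ FK _]] := alg_iso_inv F_iso; have F0 := alg_iso0 F_iso.
pose g' := psi g.
have [b [h' [h'P gE]]] : exists b h', milnor_rels k f h' /\ g' = b * f + h'.
  apply/gen_tjurina_relsP/quo_pi0/(can_inj FK).
  rewrite F0 FE psiK; apply/quo_pi0/ideal_gen_mem; by left.
have [c [h2 [h2P fE]]] : exists c h2, milnor_rels k g' h2 /\ f = c * g' + h2.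
  apply/gen_tjurina_relsP; rewrite -[X in ideal_gen _ X]phiK.
  apply: (@aut_tjurina_rels _ _ _ _ psi k g' g 1) => //; rewrite ?unitr1 ?mul1r //.
  by apply/quo_pi0; rewrite -FE -[RHS]F0; congr F; apply/quo_pi0/ideal_gen_mem; left.
have h'o := milnor_rels_ord fo h'P.
(* If b were in m, the order of g' would exceed ord f, and then so would that of f, through its
   expression by g'. *)
have bU : b \is a GRing.unit.
  apply: contrapT => /negP/ordge1_unit b1; apply: nfo.
  have g'o : ordge o.+3 g'.
    rewrite gE cpsD cpsM; apply: ordgeD; first by rewrite -add1n; exact: ordgeM.
    by apply: ordgeW h'o; move: k1; clear; lia.
  rewrite fE cpsD cpsM; apply: ordgeD; first exact: ordgeMl.
  by apply: ordgeW (milnor_rels_ord g'o h2P); move: k1; clear; lia.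
(* The perturbed series f + b^-1 h' is b^-1 g', a unit multiple of g'. *)
have [|theta thetal [w w1 E]] := @finitely_determined 1 f (b^-1 * h') d o d_gens fo od.
  rewrite cpsM; apply: ordgeMl; apply: ordgeW h'o; move: kdo; clear; lia.
have wU : 1 + w \is a GRing.unit.
  rewrite cps_unitE /cps_cst cpsD cps1 fpsD fps1 eqxx (proj1 (ordge1P _) w1).
  by rewrite addr0 oner_eq0.
have [eta [etal thetaK etaK]] := local_aut_inv thetal.
exists (eta \o psi : {lrmorphism cps n v -> cps n v}); first exact: local_aut_comp.
exists (eta ((1 + w)^-1 * b^-1)).
  by rewrite rmorph_unit // unitrM !unitrV wU.
rewrite /= -rmorphM /= -/g' -[LHS]thetaK; congr (eta _).
have -> : theta f = (1 + w)^-1 * (f + b^-1 * h').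
  by rewrite -E scale1r (mulKr wU).
by rewrite -mulrA gE [b^-1 * (_ + _)]mulrDr (mulKr bU).
Qed.

Lemma milnor_iso_right f g k d o :
    ordge o.+2 f -> ~ ordge o.+3 f -> (d + d <= k + o + o)%N ->
    (forall x : cps n v, ordge d x -> ideal_gen (jacobian_ideal f) x) ->
  milnor_iso k f g -> right_equiv f g.
Proof.
move=> fo nfo kdo dJ [F F_iso Ff].
have d_gens (x : cps n v) : ordge d x -> exists (b : cps n v) (c : 'I_n -> cps n v),
    x = 0 *: (b * f) + \sum_i c i * cps_deriv i f.
  move=> /dJ/ideal_gen_idem/jacobian_idealP[c ->].
  by exists 0, c; rewrite scale0r add0r.
have od := ord_lt_codim fo nfo d_gens; have k1 := exponent_gt1 fo nfo d_gens kdo.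
have S2 x : ideal_gen (milnor_rels k f) x -> ordge 2 x.
  by move=> /gen_milnor_rels/(milnor_rels_ord2 fo nfo d_gens kdo).
have SN (x : cps n v) : ordge (k + d) x -> ideal_gen (milnor_rels k f) x.
  move=> /(ordge_mul_gens d_gens)[w [y [_ yk ->]]].
  by rewrite scale0r add0r; apply/gen_milnor_rels/milnor_relsP; exists y.
have [phi phil FE] := alg_iso_lift F_iso S2 SN.
have [psi [psil phiK psiK]] := local_aut_inv phil.
have [F' [_ FK _]] := alg_iso_inv F_iso.
(* As F maps the class of f to that of g, psi g and f differ by an element of m^k j(f) at once: no
   unit appears, and no comparison of orders is required. *)
have hP : milnor_rels k f (psi g - f).
  apply/gen_milnor_rels/quo_eqP/eqP/(can_inj FK).
  by rewrite FE psiK Ff.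
have [|theta thetal [w w1 E]] := @finitely_determined 0 f (psi g - f) d o d_gens fo od.
  apply: ordgeW (milnor_rels_ord fo hP); move: kdo; clear; lia.
have [eta [etal thetaK etaK]] := local_aut_inv thetal.
exists (eta \o psi : {lrmorphism cps n v -> cps n v}); first exact: local_aut_comp.
rewrite /= -[LHS]thetaK; congr (eta _).
by move: E; rewrite scale0r addr0 mul1r addrC subrK.
Qed.

(** For f = 0 finite codimension gives m = 0. The isomorphism prevents g from being a unit, so that
    g lies in m and vanishes. *)
Lemma tjurina_iso_contact0 g k d :
    (forall x : cps n v, ordge d x ->
       ideal_gen ((0 : cps n v) |` jacobian_ideal (0 : cps n v)) x) ->
  tjurina_iso k 0 g -> contact_equiv 0 g.
Proof.
move=> dJ [F F_iso].
have d0 (x : cps n v) : ordge d x -> x = 0.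
  move=> /dJ/ideal_genU1P[b [y [/ideal_gen_idem/jacobian_idealP[c ->] ->]]].
  by rewrite mulr0 add0r big1 // => i _; rewrite cps_deriv0 mulr0.
have S1 x : ideal_gen (tjurina_rels k (0 : cps n v)) x -> ordge 1 x.
  move=> /gen_tjurina_relsP[a [y [/milnor_relsP[c _ ->] ->]]].
  by rewrite mulr0 add0r big1 // => i _; rewrite cps_deriv0 mulr0.
have -> : g = 0.
  apply: (ordge1_eq0 d0); apply: (alg_iso_proper F_iso S1).
  by apply: ideal_gen_mem; left.
exists idfun; first exact: local_aut_id.
by exists 1; [exact: unitr1|rewrite mul1r].
Qed.

Lemma milnor_iso_right0 g k d :
    (forall x : cps n v, ordge d x -> ideal_gen (jacobian_ideal (0 : cps n v)) x) ->
  milnor_iso k 0 g -> right_equiv 0 g.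
Proof.
move=> dJ [F F_iso Fg].
have d0 (x : cps n v) : ordge d x -> x = 0.
  move=> /dJ/ideal_gen_idem/jacobian_idealP[c ->].
  by rewrite big1 // => i _; rewrite cps_deriv0 mulr0.
have S1 x : ideal_gen (milnor_rels k (0 : cps n v)) x -> ordge 1 x.
  move=> /gen_milnor_rels/milnor_relsP[c _ ->].
  by rewrite big1 // => i _; rewrite cps_deriv0 mulr0.
have -> : g = 0.
  apply: (ordge1_eq0 d0); apply: (alg_iso_proper F_iso S1).
  by apply/quo_pi0; rewrite -Fg quo_pi_zero (alg_iso0 F_iso).
by exists idfun; first exact: local_aut_id.
Qed.

End MatherYau.

Lemma iff_exists_forall (P : Prop) (B Q : nat -> Prop) :
    (P -> forall k, Q k) -> (exists k, B k) -> (forall k, B k -> Q k -> P) ->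
  (P <-> exists k, B k /\ Q k) /\ (P <-> forall k, B k -> Q k).
Proof.
move=> PQ [k0 Bk0] QP; split; split.
- by move=> p; exists k0; split=> //; exact: PQ.
- by move=> [k [Bk Qk]]; exact: QP Bk Qk.
- by move=> p k _; exact: PQ.
- by move=> H; exact: QP Bk0 (H _ Bk0).
Qed.

(** Here [o] is the order itself; with [o.+2] in its place the inequality becomes the hypothesis
    [kdo]. *)
Lemma exponent_boundE (R : realType) (d o k : nat) :
  (2%:R%:E * (d%:R%:E - o%:R%:E + 2%:R%:E) <= k%:R%:E :> \bar R)%E =
  (d + d + 4 <= k + (o + o))%N.
Proof.
rewrite -EFinB -EFinD -EFinM lee_fin -(ler_nat R) !natrD.
by apply/idP/idP; lra.
Qed.

Lemma exponent_exists (n : nat) (R : realType) (K : fieldType) (v : absValue R K)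
    (f : cps n v) (d : nat) :
  exists k : nat, (2%:R%:E * (d%:R%:E - cps_ord f + 2%:R%:E) <= k%:R%:E)%E.
Proof.
have [->|f0] := eqVneq f 0.
  (* The order of 0 is +oo, which turns the bound into -oo, so that any exponent will do. *)
  by exists 0%N; rewrite cps_ord0 /= addNye ?gt0_muleNy ?leNye // lte_fin.
have [o [_ _ ->]] := cps_ordE f0.
by exists (d + d + 4)%N; rewrite exponent_boundE leq_addr.
Qed.

Theorem theorem1p18 (R : realType) (K : fieldType) (v : absValue R K) (n : nat)
    (f g : cps n v) (ordf : (2%:R%:E <= cps_ord f)%E) :
  ((tjurina_number f < +oo)%E ->
     (contact_equiv f g <->
        exists k : nat,
          (2%:R%:E * (tjurina_number f - cps_ord f + 2%:R%:E) <= k%:R%:E)%E /\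
          tjurina_iso k f g) /\
     (contact_equiv f g <->
        forall k : nat,
          (2%:R%:E * (tjurina_number f - cps_ord f + 2%:R%:E) <= k%:R%:E)%E ->
          tjurina_iso k f g)) /\
  ((milnor_number f < +oo)%E ->
     (right_equiv f g <->
        exists k : nat,
          (2%:R%:E * (milnor_number f - cps_ord f + 2%:R%:E) <= k%:R%:E)%E /\
          milnor_iso k f g) /\
     (right_equiv f g <->
        forall k : nat,
          (2%:R%:E * (milnor_number f - cps_ord f + 2%:R%:E) <= k%:R%:E)%E ->
          milnor_iso k f g)).
Proof.
have ord_spec : f != 0 -> exists o, [/\ ordge o.+2 f, ~ ordge o.+3 f &
    cps_ord f = o.+2%:R%:E].
  move=> /cps_ordE[o [fo nfo oE]]; move: ordf; rewrite oE lee_fin ler_nat.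
  by case: o fo nfo oE => [|[|o]] fo nfo oE // _; exists o.
split=> [/kdim_fin[d [b [bP dE]]]|/kdim_fin[d [b [bP dE]]]].
- rewrite /tjurina_number dE; apply: iff_exists_forall.
  + by move=> + k; exact: contact_tjurina_iso.
  + exact: exponent_exists.
  + move=> k; have [f0 _|f0] := eqVneq f 0.
      by have := basis_ord bP; rewrite f0; exact: tjurina_iso_contact0.
    have [o [fo nfo ->]] := ord_spec f0; rewrite exponent_boundE => kdo.
    by apply: tjurina_iso_contact fo nfo _ (basis_ord bP); lia.
- rewrite /milnor_number dE; apply: iff_exists_forall.
  + by move=> + k; exact: right_milnor_iso.
  + exact: exponent_exists.
  + move=> k; have [f0 _|f0] := eqVneq f 0.
      by have := basis_ord bP; rewrite f0; exact: milnor_iso_right0.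
    have [o [fo nfo ->]] := ord_spec f0; rewrite exponent_boundE => kdo.
    by apply: milnor_iso_right fo nfo _ (basis_ord bP); lia.
Qed.
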